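(* Let $q=3^n$ with $n\ge 1$ and suppose $E/\mathbb{F}_q$ is an elliptic curve. Then $$\#\mathrm{Twist}(E/\mathbb{F}_q)=\begin{cases}2 & \text{if } j(E)\neq 0,\\ 4 & \text{if } j(E)=0 \text{ and } n \text{ is odd},\\ 6 & \text{if } j(E)=0\text{ and } n\text{ is even}.\end{cases}$$
   Context: For an elliptic curve $E$ over a perfect field $K$ with fixed separable closure $\overline{K}$, a twist of $E$ is an elliptic curve $E^{\mathrm{tw}}/K$ that is isomorphic to $E$ over $\overline{K}$ (as elliptic curves). Two twists are considered equal if they are isomorphic over $K$. $\mathrm{Twist}(E/K)$ denotes the set of twists of $E$ (including the trivial one, $E$ itself). *)

(* Defs.v *)
From mathcomp Require Import all_boot all_order all_algebra.
From mathcomp Require Import boolp classical_sets functions cardinality.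
From mathcomp Require Import mpoly.

Set Implicit Arguments.
Unset Strict Implicit.
Unset Printing Implicit Defensive.

Import GRing.Theory.
Local Open Scope classical_set_scope.
Local Open Scope ring_scope.

(* Y^2 Z + a1 X Y Z + a3 Y Z^2 = X^3 + a2 X^2 Z + a4 X Z^2 + a6 Z^3 *)
Record weierstrass (K : Type) := Weierstrass {
  wa1 : K; wa2 : K; wa3 : K; wa4 : K; wa6 : K
}.

Section Invariants.
Variables (K : fieldType) (W : weierstrass K).
Local Notation a1 := (wa1 W).
Local Notation a2 := (wa2 W).
Local Notation a3 := (wa3 W).
Local Notation a4 := (wa4 W).
Local Notation a6 := (wa6 W).

Definition wb2 : K := a1 ^+ 2 + 4%:R * a2.
Definition wb4 : K := 2%:R * a4 + a1 * a3.
Definition wb6 : K := a3 ^+ 2 + 4%:R * a6.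
Definition wb8 : K :=
  a1 ^+ 2 * a6 + 4%:R * a2 * a6 - a1 * a3 * a4 + a2 * a3 ^+ 2 - a4 ^+ 2.
Definition wc4 : K := wb2 ^+ 2 - 24%:R * wb4.
Definition wdisc : K :=
  - wb2 ^+ 2 * wb8 - 8%:R * wb4 ^+ 3 - 27%:R * wb6 ^+ 2
  + 9%:R * wb2 * wb4 * wb6.
End Invariants.

Record ellcurve (K : fieldType) := EllCurve {
  ell_weq :> weierstrass K;
  ell_nonsing : wdisc ell_weq != 0
}.

Definition jinv (K : fieldType) (E : ellcurve K) : K := wc4 E ^+ 3 / wdisc E.

Section BaseChange.
Variables (K L : fieldType) (iota : {rmorphism K -> L}).

Definition map_weierstrass (W : weierstrass K) : weierstrass L :=
  Weierstrass (iota (wa1 W)) (iota (wa2 W)) (iota (wa3 W))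
              (iota (wa4 W)) (iota (wa6 W)).

Lemma wdisc_map (W : weierstrass K) :
  wdisc (map_weierstrass W) = iota (wdisc W).
Proof.
by rewrite /wdisc /wb2 /wb4 /wb6 /wb8 /=
  !(rmorph_nat, rmorphXn, rmorphM, rmorphB, rmorphN, rmorphD).
Qed.

Lemma map_ell_nonsing (E : ellcurve K) : wdisc (map_weierstrass E) != 0.
Proof. by rewrite wdisc_map fmorph_eq0 ell_nonsing. Qed.

Definition base_change (E : ellcurve K) : ellcurve L :=
  EllCurve (map_ell_nonsing E).
End BaseChange.

(* A point of P^2(L) is a line through the origin of L^3, so that equality of
   projective points is Leibniz equality. *)
Section Points.
Variable L : fieldType.
Local Notation pt := {vspace 'rV[L]_3}.

Definition on_cubic (W : weierstrass L) (v : 'rV[L]_3) : Prop :=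
  let X := v 0 0 in let Y := v 0 1 in let Z := v 0 2%:R in
  Y ^+ 2 * Z + wa1 W * X * Y * Z + wa3 W * Y * Z ^+ 2
  = X ^+ 3 + wa2 W * X ^+ 2 * Z + wa4 W * X * Z ^+ 2 + wa6 W * Z ^+ 3.

Definition points (E : ellcurve L) : set pt :=
  [set P | \dim P = 1%N /\ forall v, v \in P -> on_cubic E v].

(* [0 : 1 : 0] *)
Definition origin : pt := <[delta_mx 0%R 1%R]>%VS.
End Points.

(* Varieties over K are described by their points in the algebraically closed
   field L, and morphisms over K by the maps they induce on these points: near
   every L-point such a map is given by homogeneous polynomials of one common
   degree with coefficients in K. *)
Section Isomorphism.
Variables (K : fieldType) (L : closedFieldType) (iota : {rmorphism K -> L}).
Local Notation pt := {vspace 'rV[L]_3}.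

Definition homog_eval (f : 'I_3 -> {mpoly K[3]}) (v : 'rV[L]_3) : 'rV[L]_3 :=
  \row_i (map_mpoly iota (f i)).@[v 0].

Definition ell_morphism (E1 E2 : ellcurve K) (phi : pt -> pt) : Prop :=
  let C1 := points (base_change iota E1) in
  let C2 := points (base_change iota E2) in
  (forall P, C1 P -> C2 (phi P)) /\
  (forall P, C1 P ->
    exists (d : nat) (f : 'I_3 -> {mpoly K[3]}),
      [/\ forall i, f i \is d.-homog,
          exists2 v, v \in P & homog_eval f v != 0
        & forall v, C1 <[v]>%VS -> homog_eval f v != 0 ->
            phi <[v]>%VS = <[homog_eval f v]>%VS]).

Definition ell_isomorphic (E1 E2 : ellcurve K) : Prop :=
  exists phi psi : pt -> pt,
    [/\ ell_morphism E1 E2 phi, ell_morphism E2 E1 psi,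
        forall P, points (base_change iota E1) P -> psi (phi P) = P,
        forall P, points (base_change iota E2) P -> phi (psi P) = P
      & phi (origin L) = origin L].
End Isomorphism.

(* K is meant to be perfect, with iota : K -> L an algebraic closure. *)
Section Twists.
Variables (K : fieldType) (L : closedFieldType) (iota : {rmorphism K -> L}).

Definition is_twist (E E' : ellcurve K) : Prop :=
  ell_isomorphic (idfun : {rmorphism L -> L})
    (base_change iota E') (base_change iota E).

Definition Twist (E : ellcurve K) : set (set (ellcurve K)) :=
  [set C | exists2 E', is_twist E E' & C = [set E'' | ell_isomorphic iota E' E'']].
End Twists.

(* Main.v *)
Require Import Defs.
From mathcomp Require Import all_boot all_order all_algebra all_field.
From mathcomp Require Import cyclic.
From mathcomp Require Import boolp classical_sets functions cardinality.
From mathcomp Require Import mpoly.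
From mathcomp Require Import zify ring.

Set Implicit Arguments.
Unset Strict Implicit.
Unset Printing Implicit Defensive.
Import GRing.Theory.
Local Open Scope ring_scope.

(** Completing the square, which is possible as 2 is invertible, turns a
    Weierstrass equation into y^2 = 4 x^3 + b2 x^2 + 2 b4 x + b6 and leaves only
    the substitutions x -> u^2 x + r, y -> u^3 y.  The theorem follows from two
    facts: isomorphisms of elliptic curves are exactly these substitutions, and
    in characteristic 3 their orbits over a finite field can be listed.

    Isomorphisms are substitutions.  An isomorphism that fixes the point at
    infinity carries affine points to affine points, so in affine coordinates it
    is a pair (X, Y) of functions that are locally quotients of polynomials.
    Such functions are polynomial in x and y: the denominators of a function
    form an ideal without zeros on the curve, and taking norms to polynomials in
    x shows that this ideal contains 1 (regular_of_local).  Write a regular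
    function as a(x) + b(x) y and define its pole order at infinity as the
    degree of its norm a^2 - b^2 g, so that x has order 2 and y order 3.  From
    Y^2 = h(X) the orders of X and Y are 2k and 3k, hence every polynomial in X
    and Y has an order that is a multiple of k.  The inverse isomorphism writes
    x as such a polynomial, so k = 1; then X is affine in x, and comparing
    coefficients gives the substitution (iso_affine).  If the isomorphism is
    defined over K, it commutes with every endomorphism of the closed field that
    fixes K, so u and r are fixed by it as well (iso_model_change); for the Frobenius of a
    finite field this puts u and r in that field (iso_equivalent).

    Counting.  In characteristic 3 the invariants (b2, b4, b6) transform by
    u^2 b2 = b2', u^4 b4 = b4' + r b2', u^6 b6 = b6' - r b4' + r^2 b2' + r^3,
    and j = 0 means b2 = 0.

    If b2 is nonzero, a shift makes b4 = 0.  Over the closure a curve of this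
    shape is determined by b6 / b2^3, and over F_q by this ratio and the class
    of b2 modulo squares, which gives 2 twists.

    If b2 = 0, all such curves are isomorphic over the closure.  Over F_q the
    class of b4 modulo fourth powers is an invariant.  For a nonsquare b4 the
    additive map r -> r^3 - b4 r is injective, hence surjective, and b6 can be
    made 0: one class.  For b4 = h^2 this map is h^3 (t^3 - t) at r = h t, whose
    image has index 3, so that b6 = e h^3 d with e in {0, 1, -1} and d a fixed
    element outside the image of t -> t^3 - t; moreover u with u^2 = -1
    exchanges e and -e.  If n is odd, -1 is not a square and fourth powers are
    the same as squares: 1 + 3 = 4 classes.  If n is even, -1 is a square and
    there are four classes modulo fourth powers, two of them of squares:
    1 + 1 + 2 + 2 = 6 classes. *)

(** * Regular functions on the affine curve y^2 = g(x) *)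

Ltac horner_simpl := rewrite ?(hornerD, hornerN, hornerM, hornerX, hornerC,
  hornerZ, hornerXn, horner_exp, horner0).
Ltac horner_ring := horner_simpl; ring.

Lemma poly_eq0_of_horner (L : closedFieldType) (p : {poly L}) :
  (forall x, p.[x] = 0) -> p = 0.
Proof.
move=> p0; apply/eqP/negPn/negP => /closed_nonrootP[x].
by rewrite /root p0 eqxx.
Qed.

Section RegularFunctions.
Variables (L : closedFieldType) (g : {poly L}).

(** Functions are total in x and y, but only their values on the curve count. *)
Definition represents (F : L -> L -> L) (a b : {poly L}) :=
  forall x y, y ^+ 2 = g.[x] -> F x y = a.[x] + b.[x] * y.

Definition regular F := exists a b, represents F a b.

Lemma curve_point x : exists y, y ^+ 2 = g.[x].
Proof.
have := @solve_monicpoly L 2 (fun i => if i == 0%N then g.[x] else 0) isT.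
by case=> y; rewrite !big_ord_recr big_ord0 /= add0r mul0r addr0 mulr1; exists y.
Qed.

Lemma represents_cst c : represents (fun _ _ => c) c%:P 0.
Proof. by move=> x y _; horner_ring. Qed.
Lemma represents_x : represents (fun x _ => x) 'X 0.
Proof. by move=> x y _; horner_ring. Qed.

Lemma representsD F G a b c d : represents F a b -> represents G c d ->
  represents (fun x y => F x y + G x y) (a + c) (b + d).
Proof. by move=> FE GE x y xy; rewrite FE // GE //; horner_ring. Qed.

Lemma representsM F G a b c d : represents F a b -> represents G c d ->
  represents (fun x y => F x y * G x y) (a * c + b * d * g) (a * d + b * c).
Proof.
by move=> FE GE x y xy; rewrite FE // GE //; horner_simpl; rewrite -xy; ring.
Qed.

Lemma represents_eq F G a b : represents F a b ->
  (forall x y, y ^+ 2 = g.[x] -> G x y = F x y) -> represents G a b.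
Proof. by move=> FE GF x y xy; rewrite GF // FE. Qed.

Lemma regular_cst c : regular (fun _ _ => c).
Proof. by exists c%:P, 0; exact: represents_cst. Qed.
Lemma regular_x : regular (fun x _ => x).
Proof. by exists 'X, 0; exact: represents_x. Qed.
Lemma regularD F G : regular F -> regular G -> regular (fun x y => F x y + G x y).
Proof. by case=> a [b FE] [c [d GE]]; do 2!eexists; exact: representsD FE GE. Qed.
Lemma regularM F G : regular F -> regular G -> regular (fun x y => F x y * G x y).
Proof. by case=> a [b FE] [c [d GE]]; do 2!eexists; exact: representsM FE GE. Qed.
Lemma regular_eq F G : regular F ->
  (forall x y, y ^+ 2 = g.[x] -> G x y = F x y) -> regular G.
Proof. by case=> a [b FE] GF; do 2!eexists; exact: represents_eq FE GF. Qed.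
Lemma regularX F n : regular F -> regular (fun x y => F x y ^+ n).
Proof.
move=> rF; elim: n => [|n IHn]; first exact: regular_cst 1.
by apply: regular_eq (regularM rF IHn) _ => x y _; rewrite exprS.
Qed.
Lemma regular_sum (I : Type) (r : seq I) (F : I -> L -> L -> L) :
  (forall i, regular (F i)) -> regular (fun x y => \sum_(i <- r) F i x y).
Proof.
move=> rF; elim: r => [|i r IHr].
  by apply: regular_eq (regular_cst 0) _ => x y _; rewrite big_nil.
by apply: regular_eq (regularD (rF i) IHr) _ => x y _; rewrite big_cons.
Qed.
Lemma regular_prod (I : Type) (r : seq I) (F : I -> L -> L -> L) :
  (forall i, regular (F i)) -> regular (fun x y => \prod_(i <- r) F i x y).
Proof.
move=> rF; elim: r => [|i r IHr].
  by apply: regular_eq (regular_cst 1) _ => x y _; rewrite big_nil.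
by apply: regular_eq (regularM (rF i) IHr) _ => x y _; rewrite big_cons.
Qed.

(** The norm of a + b y from the coordinate ring to the polynomials in x: the
    product with its conjugate a - b y. *)
Definition pnorm (a b : {poly L}) := a ^+ 2 - b ^+ 2 * g.

Lemma pnormE a b x y : y ^+ 2 = g.[x] ->
  (pnorm a b).[x] = (a.[x] + b.[x] * y) * (a.[x] + b.[x] * - y).
Proof. by move=> xy; rewrite /pnorm; horner_simpl; rewrite -xy; ring. Qed.

Lemma pnormM a b c d :
  pnorm (a * c + b * d * g) (a * d + b * c) = pnorm a b * pnorm c d.
Proof. by rewrite /pnorm; ring. Qed.

Section Local.
Variable F : L -> L -> L.

(** The denominators of [F] form an ideal of the coordinate ring; the pair
    [(c, d)] stands for c + d y. *)
Definition denominator c d :=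
  regular (fun x y => F x y * (c.[x] + d.[x] * y)).

Lemma denominatorD c d c' d' :
  denominator c d -> denominator c' d' -> denominator (c + c') (d + d').
Proof.
by move=> D D'; apply: regular_eq (regularD D D') _ => x y _; horner_ring.
Qed.

Lemma denominator_norm c d : denominator c d -> denominator (pnorm c d) 0.
Proof.
move=> D.
have rC : regular (fun x y => c.[x] + d.[x] * - y).
  by exists c, (- d) => x y _; horner_ring.
apply: regular_eq (regularM D rC) _ => x y xy.
by rewrite (pnormE _ _ xy) hornerC mul0r addr0; ring.
Qed.

Lemma denominatorMl h p : denominator h 0 -> denominator (p * h) 0.
Proof.
move=> D; have rp : regular (fun x _ => p.[x]).
  by exists p, 0 => x y _; horner_ring.
by apply: regular_eq (regularM rp D) _ => x y _; horner_ring.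
Qed.

Hypothesis loc : forall x y, y ^+ 2 = g.[x] ->
  exists c d, denominator c d /\ c.[x] + d.[x] * y != 0.

(** The points above x are (x, y) and (x, -y).  Denominators that are nonzero at
    one of them can be added to get one that is nonzero at both, and the norm of
    the latter is a denominator that is a polynomial in x, nonzero at x. *)
Lemma denominator_nonroot x : exists2 h, denominator h 0 & h.[x] != 0.
Proof.
have [y xy] := curve_point x.
have xNy : (- y) ^+ 2 = g.[x] by rewrite sqrrN.
have [c [d [D nz]]] := loc xy; have [c' [d' [D' nz']]] := loc xNy.
have wrap e f : denominator e f -> e.[x] + f.[x] * y != 0 ->
    e.[x] + f.[x] * - y != 0 -> exists2 h, denominator h 0 & h.[x] != 0.
  move=> De n1 n2; exists (pnorm e f); first exact: denominator_norm.
  by rewrite (pnormE _ _ xy) mulf_neq0.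
have [z|] := eqVneq (c.[x] + d.[x] * - y) 0; last exact: wrap.
have [z'|] := eqVneq (c'.[x] + d'.[x] * y) 0; last by move/wrap; apply.
apply: (wrap (c + c') (d + d')); first exact: denominatorD.
  by horner_simpl; rewrite mulrDl addrACA z' addr0.
by horner_simpl; rewrite mulrDl addrACA z add0r.
Qed.

(** A nonzero denominator h(x) of minimal degree divides every denominator that
    is a polynomial in x.  A root of h would contradict denominator_nonroot, so
    h is constant. *)
Lemma regular_of_local : regular F.
Proof.
have [h0 D0 h0x] := denominator_nonroot 0.
pose P n := `[< exists h, [/\ denominator h 0, h != 0 & size h = n] >].
have exP : exists n, P n.
  exists (size h0); apply/asboolP; exists h0; split=> //.
  by apply: contraNneq h0x => ->; rewrite horner0.
case: (ex_minnP exP) => n /asboolP[h [D hn0 sh]] minh.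
have [s1|s1] := eqVneq (size h) 1%N.
  have /size_poly1P[c c0 hE] : size h == 1%N by rewrite s1.
  apply: regular_eq (regularM (regular_cst c^-1) D) _ => x y _.
  by rewrite hE hornerC horner0 mul0r addr0 mulrCA mulVf ?mulr1.
have /closed_rootP[x /rootP hx] := s1.
have [k Dk kx] := denominator_nonroot x.
have Dr : denominator (k %% h) 0.
  have -> : k %% h = k + - (k %/ h) * h by rewrite {2}(divp_eq k h); ring.
  by rewrite -[0](addr0 0); apply: denominatorD => //; apply: denominatorMl.
have r0 : k %% h = 0.
  apply/eqP/negPn/negP => rn0.
  have : (n <= size (k %% h)%R)%N by apply: minh; apply/asboolP; exists (modp k h).
  by rewrite -sh leqNgt ltn_modp hn0.
by case/negP: kx; rewrite (divp_eq k h) r0 addr0 hornerM hx mulr0.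
Qed.
End Local.

Hypothesis size_g : size g = 4%N.

Let g_neq0 : g != 0.
Proof. by rewrite -size_poly_eq0 size_g. Qed.

(** On the curve both (x, y) and (x, -y) occur, which separates the even part
    a(x) from the odd part b(x) y. *)
Lemma represents_uniq F a b c d : 2%:R != 0 :> L ->
  represents F a b -> represents F c d -> a = c /\ b = d.
Proof.
move=> two_neq0 R S.
have E x y : y ^+ 2 = g.[x] -> (a - c).[x] + (b - d).[x] * y = 0.
  move=> xy; have := R _ _ xy; rewrite (S _ _ xy) => e.
  by horner_simpl; rewrite mulrBl addrACA -opprD -e subrr.
have ac : a - c = 0.
  apply: poly_eq0_of_horner => x; have [y xy] := curve_point x.
  have e1 := E _ _ xy; have e2 : (a - c).[x] + (b - d).[x] * - y = 0.
    by apply: E; rewrite sqrrN.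
  apply: (mulfI two_neq0); rewrite mulr0 -[RHS](addr0 0) -{1}e1 -e2; ring.
split; first exact: subr0_eq.
apply/subr0_eq; have /eqP : (b - d) * g = 0; last first.
  by rewrite mulf_eq0 (negPf g_neq0) orbF => /eqP.
apply: poly_eq0_of_horner => x; have [y xy] := curve_point x.
have := E _ _ xy; rewrite ac horner0 add0r => e.
by rewrite hornerM -xy expr2 mulrA e mul0r.
Qed.

(** The degrees of a^2 and b^2 g are even and odd, so their leading terms cannot
    cancel. *)
Lemma size_pnorm a b :
  size (pnorm a b) =
    maxn ((2 * size a).-1)%N (if b == 0%R then 0 else 2 * size b + 2)%N.
Proof.
have sX2 (p : {poly L}) : size (p ^+ 2) = ((2 * size p).-1)%N.
  have [->|p0] := eqVneq p 0; first by rewrite expr0n /= !size_poly0.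
  by rewrite expr2 size_mul // addnn -mul2n.
rewrite /pnorm; have [->|b0] := eqVneq b 0.
  by rewrite expr0n /= mul0r subr0 sX2 maxn0.
have sb : size (b ^+ 2 * g) = (2 * size b + 2)%N.
  rewrite size_mul ?expf_neq0 // sX2 size_g.
  by have : (size b > 0)%N by [rewrite size_poly_gt0]; lia.
case: (ltngtP (size (a ^+ 2)) (size (b ^+ 2 * g))) => sab.
- rewrite addrC size_polyDl size_polyN // sb; apply/esym/maxn_idPr.
  by rewrite -sX2 -sb; exact: ltnW.
- rewrite size_polyDl ?size_polyN // sX2; apply/esym/maxn_idPl.
  by rewrite -sX2 -sb; exact: ltnW.
- by move: sab; rewrite sX2 sb; case: (size a) => [|m]; lia.
Qed.

Lemma size_pnormD a b c d : (size (pnorm c d) < size (pnorm a b))%N ->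
  size (pnorm (a + c) (b + d)) = size (pnorm a b).
Proof.
have := size_polyD a c; have := size_polyD b d; rewrite !size_pnorm.
have adda : (size c < size a)%N -> size (a + c) = size a by exact: size_polyDl.
have addb : (size d < size b)%N -> size (b + d) = size b by exact: size_polyDl.
rewrite -!size_poly_eq0.
case: ifP; case: ifP; case: ifP; case: (ltnP (size c) (size a)) => [/adda ->|];
  case: (ltnP (size d) (size b)) => [/addb ->|]; lia.
Qed.

(** The order of the pole of [F] at infinity, as the degree of its norm. *)
Definition pole F m := exists a b, represents F a b /\ size (pnorm a b) = m.+1.

Lemma pole_uniq F m n : 2%:R != 0 :> L -> pole F m -> pole F n -> m = n.
Proof.
move=> n2 [a [b [Rab sab]]] [c [d [Rcd scd]]].
by have [ac bd] := represents_uniq n2 Rab Rcd; move: scd; rewrite -ac -bd sab => -[].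
Qed.

Lemma pole_cst c : c != 0 -> pole (fun _ _ => c) 0.
Proof.
move=> c0; exists c%:P, 0; split; first exact: represents_cst.
by rewrite size_pnorm eqxx size_polyC c0.
Qed.

Lemma pole_x : pole (fun x _ => x) 2.
Proof.
exists 'X, 0; split; first exact: represents_x.
by rewrite size_pnorm eqxx size_polyX.
Qed.

Lemma pole_eq F G m : pole F m ->
  (forall x y, y ^+ 2 = g.[x] -> G x y = F x y) -> pole G m.
Proof.
by case=> a [b [R s]] e; exists a, b; split=> //; exact: represents_eq R e.
Qed.

Lemma poleM F G m n : pole F m -> pole G n ->
  pole (fun x y => F x y * G x y) (m + n).
Proof.
case=> a [b [Rab sab]] [c [d [Rcd scd]]]; do 2!eexists.
split; first exact: representsM Rab Rcd.
have n1 : pnorm a b != 0 by rewrite -size_poly_eq0 sab.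
have n3 : pnorm c d != 0 by rewrite -size_poly_eq0 scd.
by rewrite pnormM size_mul // sab scd addnS.
Qed.

Lemma poleD F G m n : (n < m)%N -> pole F m -> pole G n ->
  pole (fun x y => F x y + G x y) m.
Proof.
move=> nm [a [b [Rab sab]]] [c [d [Rcd scd]]]; do 2!eexists.
split; first exact: representsD Rab Rcd.
by rewrite size_pnormD ?sab // scd ltnS.
Qed.

Lemma pole_horner F m (p : {poly L}) : (0 < m)%N -> pole F m -> p != 0 ->
  pole (fun x y => p.[F x y]) (m * (size p).-1).
Proof.
move=> m0 PF; elim/poly_ind: p => [|p c IHp]; first by rewrite eqxx.
have [->|p0] := eqVneq p 0.
  rewrite mul0r add0r polyC_eq0 => c0.
  rewrite size_polyC c0 muln0.
  by apply: pole_eq (pole_cst c0) _ => x y _; rewrite hornerC.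
move=> _; have Pp : pole (fun x y => p.[F x y] * F x y) (m * size p).
  have -> : (m * size p = m * (size p).-1 + m)%N.
    by rewrite -mulnSr prednK // size_poly_gt0.
  exact: poleM (IHp p0) PF.
rewrite size_MXaddC (negPf p0) /=.
have [->|c0] := eqVneq c 0.
  by apply: pole_eq Pp _ => x y _; horner_simpl; rewrite addr0.
apply: pole_eq (poleD _ Pp (pole_cst c0)) _ => [|x y _]; last by horner_simpl.
by rewrite muln_gt0 m0 size_poly_gt0.
Qed.
End RegularFunctions.

(** The pole order of X is a positive even number 2k and that of Y is 3k.  As
    x = U(X, Y) = p(X) + q(X) Y and the orders of p(X) and q(X) Y are distinct
    multiples of k, the order 2 of x is a multiple of k of the form 2ki or
    k(2i+3), which forces k = 1. *)
Lemma iso_affine (L : closedFieldType) (g h : {poly L}) (X Y U : L -> L -> L) :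
  2%:R != 0 :> L -> size g = 4%N -> size h = 4%N ->
  lead_coef g = lead_coef h ->
  regular g X -> regular g Y -> regular h U ->
  (forall x y, y ^+ 2 = g.[x] -> Y x y ^+ 2 = h.[X x y]) ->
  (forall x y, y ^+ 2 = g.[x] -> U (X x y) (Y x y) = x) ->
  exists u r, [/\ u != 0,
    forall x y, y ^+ 2 = g.[x] -> X x y = u ^+ 2 * x + r /\ Y x y = u ^+ 3 * y
    & forall x, u ^+ 6 * g.[x] = h.[u ^+ 2 * x + r]].
Proof.
move=> n2 sg sh lgh [a [b RX]] [c [d RY]] [p [q RU]] XY UXY.
have h0 : h != 0 by rewrite -size_poly_eq0 sh.
have Ux x y : y ^+ 2 = g.[x] -> x = p.[X x y] + q.[X x y] * Y x y.
  by move=> xy; rewrite -RU ?UXY // XY.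
have Y2 : represents g (fun x y => h.[X x y]) (c * c + d * d * g) (c * d + d * c).
  apply: represents_eq (representsM RY RY) _ => x y xy.
  by rewrite -XY // expr2.
(* If X were constant, x would be affine in Y with constant coefficients, while
   Y^2 = h(X) makes Y constant. *)
have [s0 | sN] := leqP (size (pnorm g a b)) 1.
  have [b0 sa] : b = 0 /\ (size a <= 1)%N.
    move: s0; rewrite size_pnorm //; case: eqVneq => [->|]; first by split=> //; lia.
    by rewrite -size_poly_gt0; lia.
  move: RX; rewrite b0 (size1_polyC sa); set k := a`_0 => RX.
  have {}RX x y : y ^+ 2 = g.[x] -> X x y = k by move=> /RX ->; horner_ring.
  have Rx : represents g (fun x _ => x) (p.[k]%:P + q.[k] *: c) (q.[k] *: d).
    by move=> x y xy; rewrite {1}(Ux _ _ xy) RX // RY //; horner_ring.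
  have Rk := @represents_cst L g h.[k].
  have {}Rk : represents g (fun x y => h.[X x y]) h.[k]%:P 0.
    by apply: represents_eq Rk _ => x y xy; rewrite RX.
  have [E1 E2] := represents_uniq sg n2 Y2 Rk.
  have [F1 F2] := represents_uniq sg n2 Rx (@represents_x L g).
  have q0 : q.[k] != 0.
    apply/eqP => q0; move: F1; rewrite q0 scale0r addr0.
    move/(congr1 (fun z : {poly L} => size z)).
    by rewrite size_polyX size_polyC; case: (_ != _).
  have d0 : d = 0 by apply/eqP; move/eqP: F2; rewrite scaler_eq0 (negPf q0).
  have sc : size c = 2%N.
    have /(congr1 (fun z : {poly L} => size z)) : q.[k] *: c = 'X - p.[k]%:P.
      by rewrite -F1 addrAC subrr add0r.
    by rewrite size_scale // size_XsubC.
  have := congr1 (fun z : {poly L} => size z) E1; rewrite d0 mulr0 mul0r addr0.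
  have c0 : c != 0 by rewrite -size_poly_eq0 sc.
  by rewrite size_mul // sc size_polyC; case: (_ != _).
have [A sA] : exists A, size (pnorm g a b) = A.+1.
  by exists (size (pnorm g a b)).-1; rewrite prednK // ltnW.
have A0 : (0 < A)%N by move: sN; rewrite sA.
have PX : pole g X A by exists a, b.
have [B sB AB] : exists2 B, size (pnorm g c d) = B.+1 & (B + B = A * 3)%N.
  have [e [f [Re se]]] := pole_horner sg A0 PX h0.
  have [ee ef] := represents_uniq sg n2 Y2 Re.
  move: se; rewrite -ee -ef pnormM sh.
  have [->|n0] := eqVneq (pnorm g c d) 0; first by rewrite mul0r size_poly0.
  rewrite size_mul //; move: n0; rewrite -size_poly_eq0.
  by case: (size _) => // B _; rewrite addnS /= addSn => -[BB]; exists B.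
have PY : pole g Y B by exists c, d.
have A2 : A = 2%N.
  pose G x y := p.[X x y] + q.[X x y] * Y x y.
  have PG : pole g G 2 by apply: pole_eq (pole_x sg) _ => x y xy; rewrite /G -Ux.
  have uniqG m : pole g G m -> m = 2%N by move=> /(pole_uniq sg n2) /(_ PG).
  have [p0|p0] := eqVneq p 0; have [q0|q0] := eqVneq q 0.
  - have [e [f [Re]]] := PG.
    have [-> ->] : e = 0 /\ f = 0.
      apply: (represents_uniq sg n2 Re) => x y xy.
      by rewrite /G p0 q0 !horner0 !mul0r.
    by rewrite (size_pnorm sg) eqxx size_poly0.
  - have : pole g G (A * (size q).-1 + B).
      apply: pole_eq (poleM (pole_horner sg A0 PX q0) PY) _ => x y _.
      by rewrite /G p0 horner0 add0r.
    by move/uniqG; nia.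
  - have : pole g G (A * (size p).-1).
      apply: pole_eq (pole_horner sg A0 PX p0) _ => x y _.
      by rewrite /G q0 horner0 mul0r addr0.
    by move/uniqG; nia.
  have Pp := pole_horner sg A0 PX p0.
  have Pq := poleM (pole_horner sg A0 PX q0) PY.
  case: (ltngtP (A * (size p).-1) (A * (size q).-1 + B)) => Apq.
  - have : pole g G (A * (size q).-1 + B).
      by apply: pole_eq (poleD sg Apq Pq Pp) _ => x y _; rewrite /G addrC.
    by move/uniqG; nia.
  - by have /uniqG := poleD sg Apq Pp Pq; nia.
  have : (A * (2 * (size p).-1) == A * (2 * (size q).-1 + 3))%N by apply/eqP; nia.
  by rewrite eqn_pmul2l //; lia.
(* Pole orders 2 and 3 leave only X = alpha x + r and Y = beta y + c(x). *)
have B3 : B = 3%N by lia.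
move: sA sB; rewrite !size_pnorm // A2 B3 => sA sB.
have [b0 sa] : b = 0 /\ size a = 2%N.
  move: sA; case: eqVneq => [->|]; last by rewrite -size_poly_gt0; lia.
  by split=> //; lia.
have [sd sc] : size d = 1%N /\ (size c <= 2)%N.
  by move: sB; case: eqVneq => [->|]; rewrite -?size_poly_gt0 ?size_poly0; lia.
have {sd} /size_poly1P[beta beta0 dE] : size d == 1%N by rewrite sd.
have aE : a = a`_1 *: 'X + (a`_0)%:P.
  apply/polyP => -[|[|i]]; rewrite coefD coefZ coefX coefC /=; try by ring.
  by rewrite nth_default ?sa //; ring.
have la : lead_coef a = a`_1 by rewrite /lead_coef sa.
have alpha0 : a`_1 != 0 by rewrite -la lead_coef_eq0 -size_poly_eq0 sa.
set alpha := a`_1 in la aE alpha0; set r := a`_0 in aE.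
have RhX : represents g (fun x y => h.[X x y]) (h \Po a) 0.
  by move=> x y xy; rewrite horner_comp RX // b0 !horner0 !mul0r !addr0.
have [E1 E2] := represents_uniq sg n2 Y2 RhX.
have c0 : c = 0.
  have /eqP : (2%:R * beta) *: c = 0.
    by rewrite -E2 dE -mul_polyC; rewrite polyCM; ring.
  by rewrite scaler_eq0 mulf_eq0 (negPf n2) (negPf beta0) /= => /eqP.
have gh x : beta ^+ 2 * g.[x] = h.[alpha * x + r].
  have := congr1 (fun z : {poly L} => z.[x]) E1.
  rewrite horner_comp c0 dE aE; horner_simpl => <-; ring.
have lc : alpha ^+ 3 = beta ^+ 2.
  have lg0 : lead_coef h != 0 by rewrite lead_coef_eq0.
  apply: (mulfI lg0); have := congr1 lead_coef E1.
  rewrite lead_coef_comp ?sa // sh la c0 dE mul0r add0r -rmorphM mul_polyC.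
  by rewrite lead_coefZ lgh => <-; ring.
have u2 : (beta / alpha) ^+ 2 = alpha.
  by rewrite expr_div_n -lc; field.
have u3 : (beta / alpha) ^+ 3 = beta.
  by rewrite exprS u2; field.
exists (beta / alpha), r; rewrite u2 u3; split.
- by rewrite mulf_neq0 ?invr_eq0.
- move=> x y xy; rewrite RX // RY // b0 c0 dE aE; horner_simpl; split; ring.
move=> x; rewrite -gh; congr (_ * _).
by rewrite -[RHS](congr1 (fun z => z ^+ 2) u3); ring.
Qed.

(** * Points of a Weierstrass cubic in affine coordinates *)

Section WeierstrassPoints.
Variable L : fieldType.
Implicit Types (v w : 'rV[L]_3) (P : {vspace 'rV[L]_3}).

Definition vec3 (x y z : L) : 'rV[L]_3 := \row_i nth 0 [:: x; y; z] i.

Lemma vec3E v : v = vec3 (v 0 0) (v 0 1) (v 0 2%:R).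
Proof.
apply/rowP => -[[|[|[|//]]] lti]; rewrite !mxE /=; congr (v _ _); exact: val_inj.
Qed.

Lemma vec3_0 x y z : vec3 x y z 0 0 = x. Proof. by rewrite mxE. Qed.
Lemma vec3_1 x y z : vec3 x y z 0 1 = y. Proof. by rewrite mxE. Qed.
Lemma vec3_2 x y z : vec3 x y z 0 2%:R = z. Proof. by rewrite mxE. Qed.
Definition vec3_simp := (vec3_0, vec3_1, vec3_2).

Lemma scale_vec3 k x y z : k *: vec3 x y z = vec3 (k * x) (k * y) (k * z).
Proof. by rewrite [LHS]vec3E; congr vec3; rewrite !mxE. Qed.

Lemma line_scale k v : k != 0 -> <[k *: v]>%VS = <[v]>%VS.
Proof.
move=> k0; apply/eqP; rewrite eqEsubv -!memvE; apply/andP; split.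
  by rewrite memvZ ?memv_line.
by apply/vlineP; exists k^-1; rewrite scalerA mulVf ?scale1r.
Qed.

Lemma line_mem P v : \dim P = 1%N -> v \in P -> v != 0 -> P = <[v]>%VS.
Proof.
move=> dP vP v0; apply/esym/eqP.
by rewrite eqEdim -memvE vP dP dim_vline v0.
Qed.

Lemma line_inj v w : v != 0 -> <[v]>%VS = <[w]>%VS -> exists2 k, k != 0 & v = k *: w.
Proof.
move=> v0 vw; have /vlineP[k vE] : v \in <[w]>%VS by rewrite -vw memv_line.
by exists k => //; apply: contraNneq v0 => k0; rewrite vE k0 scale0r.
Qed.

Lemma vpick_line v : v != 0 -> exists2 k, k != 0 & vpick <[v]>%VS = k *: v.
Proof.
move=> v0; have /vlineP[k E] := memv_pick <[v]>%VS.
exists k => //; have : vpick <[v]>%VS != 0.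
  by rewrite vpick0 -dimv_eq0 dim_vline v0.
by apply: contraNneq => k0; rewrite E k0 scale0r.
Qed.

Lemma on_cubic_scale W k v : on_cubic W v -> on_cubic W (k *: v).
Proof.
rewrite /on_cubic !mxE => e; transitivity (k ^+ 3 * (v 0 1 ^+ 2 * v 0 2%:R
  + wa1 W * v 0 0 * v 0 1 * v 0 2%:R + wa3 W * v 0 1 * v 0 2%:R ^+ 2)).
  by ring.
by rewrite e; ring.
Qed.

Lemma points_line (E : ellcurve L) v : v != 0 ->
  points E <[v]>%VS <-> on_cubic E v.
Proof.
move=> v0; split=> [[_]|vE]; first by apply; rewrite memv_line.
split; first by rewrite dim_vline v0.
by move=> w /vlineP[k ->]; apply: on_cubic_scale.
Qed.

(** The right-hand side after completing the square: the coordinate used below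
    is y = 2 Y + a1 X + a3 for the affine coordinates X, Y of the curve. *)
Definition wcubic (W : weierstrass L) : {poly L} :=
  ((4%:R%:P * 'X + (wb2 W)%:P) * 'X + (2%:R * wb4 W)%:P) * 'X + (wb6 W)%:P.

Lemma wcubicE W x : (wcubic W).[x] =
  4%:R * x ^+ 3 + wb2 W * x ^+ 2 + 2%:R * wb4 W * x + wb6 W.
Proof. by rewrite /wcubic; horner_ring. Qed.

Lemma on_cubicE W v : 2%:R != 0 :> L -> on_cubic W v <->
  (2%:R * v 0 1 + wa1 W * v 0 0 + wa3 W * v 0 2%:R) ^+ 2 * v 0 2%:R =
  4%:R * v 0 0 ^+ 3 + wb2 W * v 0 0 ^+ 2 * v 0 2%:R
  + 2%:R * wb4 W * v 0 0 * v 0 2%:R ^+ 2 + wb6 W * v 0 2%:R ^+ 3.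
Proof.
move=> n2; have n4 : 4%:R != 0 :> L by rewrite (natrM L 2 2) mulf_neq0.
rewrite /on_cubic /wb2 /wb4 /wb6; move: (v 0 0) (v 0 1) (v 0 2%:R) => x y z.
split=> e.
  apply/eqP; rewrite -subr_eq0 -(mulr0 4%:R).
  rewrite -(subrr (y ^+ 2 * z + wa1 W * x * y * z + wa3 W * y * z ^+ 2)) {2}e.
  by apply/eqP; ring.
apply: (mulfI n4); apply/eqP; rewrite -subr_eq0.
rewrite -(subrr ((2%:R * y + wa1 W * x + wa3 W * z) ^+ 2 * z)) {2}e.
by apply/eqP; ring.
Qed.

Section Wcubic.
Hypothesis n2 : 2%:R != 0 :> L.
Let n4 : 4%:R != 0 :> L. Proof. by rewrite (natrM L 2 2) mulf_neq0. Qed.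
Variable W : weierstrass L.

Lemma size_wcubic : size (wcubic W) = 4%N.
Proof.
have n4P : (4%:R%:P : {poly L}) != 0 by rewrite polyC_eq0.
have step (p : {poly L}) c : p != 0 -> size (p * 'X + c%:P) = (size p).+1.
  by move=> p0; rewrite size_MXaddC (negPf p0).
have nz (p : {poly L}) c : p != 0 -> p * 'X + c%:P != 0.
  by move=> p0; rewrite -size_poly_eq0 step.
by rewrite !step ?nz // size_polyC n4.
Qed.

Lemma lead_coef_wcubic : lead_coef (wcubic W) = 4%:R.
Proof.
rewrite /lead_coef size_wcubic /wcubic.
by rewrite !(coefD, coefMX, coefC, coefCM, coefX) /= !addr0.
Qed.

Definition affine_pt x y := vec3 x ((y - wa1 W * x - wa3 W) / 2%:R) 1.

(** Any nonzero vector of the line [P] gives the same quotients, so the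
    coordinates can be read off the vector chosen by [vpick]. *)
Definition xcoord (P : {vspace 'rV[L]_3}) :=
  let v := vpick P in v 0 0 / v 0 2%:R.
Definition ycoord (P : {vspace 'rV[L]_3}) :=
  let v := vpick P in
  (2%:R * v 0 1 + wa1 W * v 0 0 + wa3 W * v 0 2%:R) / v 0 2%:R.

Lemma affine_neq0 x y : affine_pt x y != 0.
Proof.
apply/eqP => /rowP/(_ 2%:R); rewrite /affine_pt vec3_2 mxE.
by apply/eqP; exact: oner_neq0.
Qed.

Lemma xcoord_line v : v 0 2%:R != 0 -> xcoord <[v]> = v 0 0 / v 0 2%:R.
Proof.
move=> z0; have [|k k0 E] := @vpick_line v.
  by apply: contraNneq z0 => ->; rewrite mxE.
by rewrite /xcoord E !mxE; field; rewrite z0 k0.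
Qed.

Lemma ycoord_line v : v 0 2%:R != 0 ->
  ycoord <[v]> = (2%:R * v 0 1 + wa1 W * v 0 0 + wa3 W * v 0 2%:R) / v 0 2%:R.
Proof.
move=> z0; have [|k k0 E] := @vpick_line v.
  by apply: contraNneq z0 => ->; rewrite mxE.
by rewrite /ycoord E !mxE; field; rewrite z0 k0.
Qed.

Lemma xcoord_affine x y : xcoord <[affine_pt x y]> = x.
Proof. by rewrite xcoord_line /affine_pt ?vec3_simp ?oner_eq0 // divr1. Qed.

Lemma ycoord_affine x y : ycoord <[affine_pt x y]> = y.
Proof.
by rewrite ycoord_line /affine_pt ?vec3_simp ?oner_eq0 // divr1 mulr1; field.
Qed.

Lemma on_cubic_affine x y :
  on_cubic W (affine_pt x y) <-> y ^+ 2 = (wcubic W).[x].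
Proof.
rewrite on_cubicE // wcubicE !vec3_simp !expr1n !mulr1.
have -> // : 2%:R * ((y - wa1 W * x - wa3 W) / 2%:R) + wa1 W * x + wa3 W = y.
by field.
Qed.

Lemma line_affine v : v 0 2%:R != 0 ->
  <[v]>%VS = <[affine_pt (xcoord <[v]>) (ycoord <[v]>)]>%VS.
Proof.
move=> z0; rewrite xcoord_line // ycoord_line //.
rewrite -(@line_scale (v 0 2%:R)^-1 v) ?invr_eq0 //; congr (<[_]>%VS).
rewrite [LHS]vec3E !mxE /affine_pt; congr vec3; field.
- by [].
- by rewrite n2 z0.
- by [].
Qed.
End Wcubic.

Lemma origin_neq_affine W x y : <[affine_pt W x y]>%VS <> origin L.
Proof.
move/(line_inj (affine_neq0 W x y)) => [k _ /rowP/(_ 2%:R)].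
rewrite /affine_pt vec3_2 !mxE /= mulr0; apply/eqP; exact: oner_neq0.
Qed.

(** A point with Z = 0 satisfies X^3 = 0, so it is the origin. *)
Lemma points_affine (E : ellcurve L) P :
  2%:R != 0 :> L -> points E P -> P <> origin L ->
  ycoord E P ^+ 2 = (wcubic E).[xcoord P] /\
  P = <[affine_pt E (xcoord P) (ycoord E P)]>%VS.
Proof.
move=> n2 EP PO; have [dP onP] := EP.
have v0 : vpick P != 0 by rewrite vpick0 -dimv_eq0 dP.
set v := vpick P in v0.
have PE : P = <[v]>%VS by apply: line_mem => //; exact: memv_pick.
have Ev : on_cubic E v by apply: onP; exact: memv_pick.
have z0 : v 0 2%:R != 0.
  apply/eqP => z0; move: Ev; rewrite /on_cubic z0 !expr0n /= !mulr0 !addr0.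
  move/esym/eqP; rewrite expf_eq0 /= => /eqP x0; apply: PO; rewrite PE.
  have y0 : v 0 1 != 0.
    apply: contraNneq v0 => y0; rewrite (vec3E v) x0 y0 z0.
    by apply/eqP/rowP => -[[|[|[|//]]] ?]; rewrite !mxE.
  rewrite /origin -(line_scale (delta_mx 0 1) y0); congr (<[_]>%VS).
  rewrite (vec3E v) x0 z0.
  by apply/rowP => -[[|[|[|//]]] ?]; rewrite !mxE /= ?mulr0 ?mulr1.
have PA := line_affine n2 E z0; rewrite -PE in PA.
split=> //; apply/(on_cubic_affine n2); apply: onP.
have := memv_line (affine_pt E (xcoord P) (ycoord E P)); by rewrite -PA.
Qed.
End WeierstrassPoints.

(** * Isomorphisms are substitutions *)

Section HomogEval.
Variables (K : fieldType) (L : closedFieldType) (iota : {rmorphism K -> L}).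

Lemma meval_map_mpoly (p : {mpoly K[3]}) (h : 'I_3 -> L) :
  (map_mpoly iota p).@[h] =
  \sum_(m <- msupp p) iota p@_m * \prod_i h i ^+ m i.
Proof.
rewrite {1}(mpolyE p) (raddf_sum (map_mpoly iota)) (raddf_sum (meval h)).
apply: eq_bigr => m _ /=.
by rewrite map_mpolyZ map_mpolyX mevalZ mevalX.
Qed.

Lemma homog_eval_scale d (f : 'I_3 -> {mpoly K[3]}) k (v : 'rV[L]_3) :
  (forall i, f i \is d.-homog) ->
  homog_eval iota f (k *: v) = k ^+ d *: homog_eval iota f v.
Proof.
move=> fd; apply/rowP => i; rewrite !mxE !meval_map_mpoly mulr_sumr.
rewrite !big_seq; apply: eq_bigr => m mf.
have <- : mdeg m = d by apply: (dhomog_mf (fd i)).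
rewrite mulrCA; congr (_ * _).
rewrite mdegE -prodrXr -big_split /=; apply: eq_bigr => j _.
by rewrite mxE exprMn.
Qed.

Lemma homog_eval_map (s : {rmorphism L -> L}) (f : 'I_3 -> {mpoly K[3]}) v :
  (forall a, s (iota a) = iota a) ->
  homog_eval iota f (map_mx s v) = map_mx s (homog_eval iota f v).
Proof.
move=> s_id; apply/rowP => i; rewrite !mxE !meval_map_mpoly rmorph_sum.
apply: eq_bigr => m _ /=; rewrite rmorphM s_id rmorph_prod; congr (_ * _).
by apply: eq_bigr => j _; rewrite mxE rmorphXn.
Qed.

Lemma regular_homog_eval (g : {poly L}) (W : weierstrass L) f i :
  regular g (fun x y => homog_eval iota f (affine_pt W x y) 0 i).
Proof.
apply: regular_eq (_ : regular g (fun x y => \sum_(m <- msupp (f i))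
    iota (f i)@_m * \prod_j affine_pt W x y 0 j ^+ m j)) _; last first.
  by move=> x y _; rewrite mxE meval_map_mpoly.
apply: regular_sum => m; apply: regularM; first exact: regular_cst.
apply: regular_prod => j; apply: regularX.
case: j => -[|[|[|//]]] ltj.
- by apply: regular_eq (regular_x g) _ => x y _; rewrite mxE.
- exists (((- wa1 W) *: 'X - (wa3 W)%:P) * (2%:R^-1)%:P), (2%:R^-1)%:P => x y _.
  by rewrite mxE /=; horner_ring.
- by apply: regular_eq (regular_cst g 1) _ => x y _; rewrite mxE.
Qed.
End HomogEval.

Section MapInvariants.
Variables (K L : fieldType) (iota : {rmorphism K -> L}) (W : weierstrass K).
Lemma wb2_map : wb2 (map_weierstrass iota W) = iota (wb2 W).
Proof. by rewrite /wb2 /= !(rmorph_nat, rmorphXn, rmorphM, rmorphD). Qed.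
Lemma wb4_map : wb4 (map_weierstrass iota W) = iota (wb4 W).
Proof. by rewrite /wb4 /= !(rmorph_nat, rmorphXn, rmorphM, rmorphD). Qed.
Lemma wb6_map : wb6 (map_weierstrass iota W) = iota (wb6 W).
Proof. by rewrite /wb6 /= !(rmorph_nat, rmorphXn, rmorphM, rmorphD). Qed.
End MapInvariants.

Section Morphisms.
Variables (K : fieldType) (L : closedFieldType) (iota : {rmorphism K -> L}).
Hypothesis n2 : 2%:R != 0 :> L.
Implicit Types E : ellcurve K.
Local Notation bc := (base_change iota).
Local Notation pt := {vspace 'rV[L]_3}.

Section Regular.
Variables (E1 E2 : ellcurve K) (phi : pt -> pt).
Hypothesis phiM : ell_morphism iota E1 E2 phi.
Hypothesis phiO : forall P, points (bc E1) P -> P <> origin L -> phi P <> origin L.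
Let g1 := wcubic (bc E1).
Let P1 x y := <[affine_pt (bc E1) x y]>%VS.

Lemma affine_point x y : y ^+ 2 = g1.[x] -> points (bc E1) (P1 x y).
Proof.
by move=> xy; apply/points_line; rewrite ?affine_neq0 //; apply/on_cubic_affine.
Qed.

Lemma morphism_affine x y : y ^+ 2 = g1.[x] ->
  ycoord (bc E2) (phi (P1 x y)) ^+ 2 =
    (wcubic (bc E2)).[xcoord (phi (P1 x y))] /\
  phi (P1 x y) = <[affine_pt (bc E2) (xcoord (phi (P1 x y)))
                    (ycoord (bc E2) (phi (P1 x y)))]>%VS.
Proof.
move=> xy; have Pxy := affine_point xy; apply: points_affine => //.
  exact: (phiM.1 _ Pxy).
by apply: phiO => //; exact: origin_neq_affine.
Qed.

Lemma morphism_local x y : y ^+ 2 = g1.[x] -> exists f : 'I_3 -> {mpoly K[3]},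
  homog_eval iota f (affine_pt (bc E1) x y) != 0 /\
  forall x' y', y' ^+ 2 = g1.[x'] ->
    let w := homog_eval iota f (affine_pt (bc E1) x' y') in
    w != 0 -> w 0 2%:R != 0 /\ phi (P1 x' y') = <[w]>%VS.
Proof.
move=> xy; have [d [f [fd [v vP fv] fphi]]] := phiM.2 _ (affine_point xy).
exists f; split.
  have /vlineP[k vE] := vP; apply: contraNneq fv => f0.
  by rewrite vE (homog_eval_scale iota k (affine_pt (bc E1) x y) fd) f0 scaler0.
move=> x' y' xy' w w0; have phiE := fphi _ (affine_point xy') w0.
split=> //; have [_] := morphism_affine xy'; rewrite phiE => E.
have [k k0] := line_inj w0 E; rewrite -/w => ->.
by rewrite mxE /affine_pt vec3_2 mulr1.
Qed.

(** Near each point the coordinates of the image are w0 / w2 and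
    (2 w1 + a1 w0 + a3 w2) / w2 for polynomials w0, w1, w2 in x and y.  The
    product of such a coordinate with w2 is polynomial on the whole curve: where
    w vanishes, both sides are 0. *)
Lemma morphism_regular :
  regular g1 (fun x y => xcoord (phi (P1 x y))) /\
  regular g1 (fun x y => ycoord (bc E2) (phi (P1 x y))).
Proof.
pose w f x y := homog_eval iota f (affine_pt (bc E1) x y).
have key (F : pt -> L) (N : 'rV[L]_3 -> L) :
    (forall v : 'rV[L]_3, v 0 2%:R != 0 -> F <[v]>%VS = N v / v 0 2%:R) -> N 0 = 0 ->
    (forall f, regular g1 (fun x y => N (w f x y))) ->
    regular g1 (fun x y => F (phi (P1 x y))).
  move=> FE N0 rN; apply: regular_of_local => x y xy.
  have [f [fnz fP]] := morphism_local xy.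
  have [c [d cd]] := regular_homog_eval iota g1 (bc E1) f 2%:R.
  exists c, d; split; last by rewrite -cd //; case: (fP _ _ xy fnz).
  apply: regular_eq (rN f) _ => x' y' xy'; rewrite -cd //.
  have [w0|w0] := eqVneq (w f x' y') 0.
    by rewrite -/(w f x' y') w0 N0 mxE mulr0.
  have [z0 ->] := fP _ _ xy' w0.
  by rewrite FE // mulfVK.
have rw f i : regular g1 (fun x y => w f x y 0 i) by exact: regular_homog_eval.
split; [apply: (key _ (fun v => v 0 0)) | apply: (key _ (fun v =>
   2%:R * v 0 1 + wa1 (bc E2) * v 0 0 + wa3 (bc E2) * v 0 2%:R))] => //.
- exact: xcoord_line.
- by rewrite mxE.
- exact: ycoord_line.
- by rewrite !mxE !mulr0 !addr0.
by move=> f; do 2?[apply: regularD]; apply: regularM => //; exact: regular_cst.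
Qed.
End Regular.

(** The effect on b2, b4, b6 of the substitution x -> u^2 x + r combined with
    y -> u^3 y from [W] to [W']. *)
Definition model_change (F : fieldType) (u r : F) (W W' : weierstrass F) :=
  [/\ u != 0, u ^+ 2 * wb2 W = wb2 W' + 12%:R * r,
      u ^+ 4 * wb4 W = wb4 W' + r * wb2 W' + 6%:R * r ^+ 2
    & u ^+ 6 * wb6 W =
        wb6 W' + 2%:R * r * wb4 W' + r ^+ 2 * wb2 W' + 4%:R * r ^+ 3].

Lemma model_change_of_wcubic (W W' : weierstrass L) u r : u != 0 ->
  (forall x, u ^+ 6 * (wcubic W).[x] = (wcubic W').[u ^+ 2 * x + r]) ->
  model_change u r W W'.
Proof.
move=> u0 e.
pose A := u ^+ 4 * (u ^+ 2 * wb2 W - (wb2 W' + 12%:R * r)).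
pose B := 2%:R * u ^+ 2 *
  (u ^+ 4 * wb4 W - (wb4 W' + r * wb2 W' + 6%:R * r ^+ 2)).
pose C := u ^+ 6 * wb6 W -
  (wb6 W' + 2%:R * r * wb4 W' + r ^+ 2 * wb2 W' + 4%:R * r ^+ 3).
have p0 : A *: 'X^2 + B *: 'X + C%:P = 0.
  apply: poly_eq0_of_horner => x; have := e x; rewrite !wcubicE => /eqP.
  rewrite -subr_eq0 => /eqP <-; rewrite /A /B /C; horner_ring.
have coef i := congr1 (fun p : {poly L} => p`_i) p0.
have [C0 B0 A0] := And3 (coef 0%N) (coef 1%N) (coef 2%N).
rewrite !(coefD, coefZ, coefXn, coefX, coefC) /= in C0 B0 A0.
rewrite !(mulr0, mulr1, addr0, add0r) in C0 B0 A0.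
split=> //; apply/eqP; rewrite -subr_eq0; apply/eqP => //.
- by apply: (mulfI (expf_neq0 4 u0)); rewrite mulr0.
- by apply: (mulfI (mulf_neq0 n2 (expf_neq0 2 u0))); rewrite mulr0.
Qed.

(** The parameters u and r are determined by the map on points, and this map
    commutes with the endomorphisms [s] because its local equations have
    coefficients in K. *)
Theorem iso_model_change E1 E2 : ell_isomorphic iota E1 E2 ->
  exists u r : L, model_change u r (bc E1) (bc E2) /\
    forall s : {rmorphism L -> L}, (forall a, s (iota a) = iota a) ->
      s u = u /\ s r = r.
Proof.
case=> phi [psi [phiM psiM phiK psiK phiO]].
have psiO : psi (origin L) = origin L.
  rewrite -{1}phiO phiK //; apply/points_line; first last.
    by rewrite /on_cubic !mxE /= !(mulr0, expr0n, addr0).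
  by apply/eqP => /rowP/(_ 1); rewrite !mxE /=; apply/eqP; exact: oner_neq0.
have phiN P : points (bc E1) P -> P <> origin L -> phi P <> origin L.
  by move=> PE PO e; apply: PO; rewrite -(phiK _ PE) e.
have psiN P : points (bc E2) P -> P <> origin L -> psi P <> origin L.
  by move=> PE PO e; apply: PO; rewrite -(psiK _ PE) e.
set g1 := wcubic (bc E1); set g2 := wcubic (bc E2).
pose P1 x y := <[affine_pt (bc E1) x y]>%VS.
pose P2 x y := <[affine_pt (bc E2) x y]>%VS.
have [rX rY] := morphism_regular phiM phiN.
have [rU _] := morphism_regular psiM psiN.
have onP2 x y (xy : y ^+ 2 = g1.[x]) := morphism_affine phiM phiN xy.
have [|||x y xy|x y xy|u [r [u0 XY gu]]] :=
  iso_affine n2 _ _ _ rX rY rU; rewrite ?size_wcubic ?lead_coef_wcubic //.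
- by case: (onP2 _ _ xy).
- rewrite -(onP2 _ _ xy).2 phiK; last exact: affine_point.
  by rewrite xcoord_affine.
exists u, r; split; first exact: model_change_of_wcubic.
have phiE x y : y ^+ 2 = g1.[x] -> phi (P1 x y) = P2 (u ^+ 2 * x + r) (u ^+ 3 * y).
  by move=> xy; rewrite {1}(onP2 _ _ xy).2; have [-> ->] := XY _ _ xy.
move=> s s_id.
have s_apt E x y :
    map_mx s (affine_pt (bc E) x y) = affine_pt (bc E) (s x) (s y).
  apply/rowP => -[[|[|[|//]]] lti]; rewrite !mxE //= ?rmorph1 //.
  by rewrite fmorph_div rmorph_nat !rmorphB rmorphM !s_id.
have sg1 x y : y ^+ 2 = g1.[x] -> s y ^+ 2 = g1.[s x].
  move=> xy; rewrite -rmorphXn xy !wcubicE.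
  rewrite !(wb2_map, wb4_map, wb6_map).
  by rewrite !(rmorph_nat, rmorphXn, rmorphM, rmorphD, s_id).
have equiv x y : y ^+ 2 = g1.[x] ->
    s (u ^+ 2 * x + r) = u ^+ 2 * s x + r /\ s (u ^+ 3 * y) = u ^+ 3 * s y.
  move=> xy; have [f [f0 fP]] := morphism_local phiM phiN xy.
  have [_ fE] := fP _ _ xy f0; have sxy := sg1 _ _ xy.
  have sE := homog_eval_map f (affine_pt (bc E1) x y) s_id.
  have sf0 : homog_eval iota f (affine_pt (bc E1) (s x) (s y)) != 0.
    by rewrite -s_apt sE map_mx_eq0.
  have [_ sfE] := fP _ _ sxy sf0.
  have e : P2 (s (u ^+ 2 * x + r)) (s (u ^+ 3 * y)) =
           P2 (u ^+ 2 * s x + r) (u ^+ 3 * s y).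
    rewrite -[RHS]phiE // /P1 sfE -s_apt sE.
    rewrite -/(P1 x y) phiE // in fE.
    have [k k0 ->] := line_inj f0 (esym fE).
    by rewrite map_mxZ s_apt line_scale // fmorph_eq0.
  split; first by have := congr1 (@xcoord L) e; rewrite !xcoord_affine.
  by have := congr1 (ycoord (bc E2)) e; rewrite !ycoord_affine.
have sr : s r = r.
  have [y xy] := curve_point g1 0; have [+ _] := equiv _ _ xy.
  by rewrite rmorph0 !mulr0 !add0r.
have su2 : s (u ^+ 2) = u ^+ 2.
  have [y xy] := curve_point g1 1; have [+ _] := equiv _ _ xy.
  by rewrite rmorph1 !mulr1 rmorphD sr => /addIr.
have su3 : s (u ^+ 3) = u ^+ 3.
  have /closed_nonrootP[x gx] : g1 != 0 by rewrite -size_poly_eq0 size_wcubic.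
  have [y xy] := curve_point g1 x; have [_] := equiv _ _ xy.
  rewrite rmorphM => /mulIf; apply; rewrite fmorph_eq0.
  by apply: contraNneq gx => y0; rewrite /root -xy y0 expr0n.
split=> //.
have -> : u = u ^+ 3 / u ^+ 2 by field.
by rewrite fmorph_div su3 su2.
Qed.
End Morphisms.

(** * Substitutions are isomorphisms *)

Section ModelChange.
Variable F : fieldType.
Implicit Types (W : weierstrass F) (v : 'rV[F]_3).

Lemma model_change_refl W : model_change 1 0 W W.
Proof. by split; [exact: oner_neq0 | ring..]. Qed.

Lemma model_change_target u r W W' : model_change u r W W' ->
  [/\ wb2 W' = u ^+ 2 * wb2 W - 12%:R * r,
      wb4 W' = u ^+ 4 * wb4 W - r * wb2 W' - 6%:R * r ^+ 2
    & wb6 W' = u ^+ 6 * wb6 W - 2%:R * r * wb4 W' - r ^+ 2 * wb2 W'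
               - 4%:R * r ^+ 3].
Proof. by case=> _ -> -> ->; split; ring. Qed.

Lemma model_change_trans u r u' r' W W' W'' :
  model_change u r W W' -> model_change u' r' W' W'' ->
  model_change (u * u') (u' ^+ 2 * r + r') W W''.
Proof.
move=> ch ch'; have [u0 _ _ _] := ch; have [u0' _ _ _] := ch'.
have [E2 E4 E6] := model_change_target ch.
have [E2' E4' E6'] := model_change_target ch'.
split; first by rewrite mulf_neq0.
- by rewrite E2' E2; ring.
- by rewrite E4' E2' E4 E2; ring.
- by rewrite E6' E4' E2' E6 E4 E2; ring.
Qed.

Lemma model_change_sym u r W W' : model_change u r W W' ->
  model_change u^-1 (- r / u ^+ 2) W' W.
Proof.
move=> ch; have [u0 _ _ _] := ch; have [E2 E4 E6] := model_change_target ch.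
split; first by rewrite invr_eq0.
- by rewrite E2; field.
- by rewrite E4 E2; field.
- by rewrite E6 E4 E2; field.
Qed.

(** The coefficients of the second coordinate are such that 2 Y + a1 X + a3 Z is
    multiplied by u^3. *)
Definition change_map u r W W' v : 'rV[F]_3 :=
  vec3 (u ^+ 2 * v 0 0 + r * v 0 2%:R)
       (u ^+ 3 * v 0 1 + (u ^+ 3 * wa1 W - wa1 W' * u ^+ 2) / 2%:R * v 0 0
        + (u ^+ 3 * wa3 W - wa3 W' - wa1 W' * r) / 2%:R * v 0 2%:R)
       (v 0 2%:R).

Lemma change_map_scale u r W W' k v :
  change_map u r W W' (k *: v) = k *: change_map u r W W' v.
Proof. by rewrite /change_map scale_vec3 !mxE; congr vec3; ring. Qed.

Hypothesis n2 : 2%:R != 0 :> F.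

Lemma change_mapK u r W W' v : u != 0 ->
  change_map u^-1 (- r / u ^+ 2) W' W (change_map u r W W' v) = v.
Proof.
move=> u0; rewrite [RHS]vec3E /change_map !vec3_simp; congr vec3; field => //.
by rewrite u0 n2.
Qed.

Lemma change_map_neq0 u r W W' v : u != 0 -> v != 0 -> change_map u r W W' v != 0.
Proof.
move=> u0; apply: contraNneq => v0.
rewrite -(change_mapK r W W' v u0) v0 -(scale0r 0) change_map_scale scale0r.
by rewrite scale0r.
Qed.

Lemma on_cubic_change u r W W' v : model_change u r W W' ->
  on_cubic W v -> on_cubic W' (change_map u r W W' v).
Proof.
case=> u0 e2 e4 e6; rewrite !on_cubicE // !vec3_simp.
move: (v 0 0) (v 0 1) (v 0 2%:R) => x y z e.
have -> : 2%:R * (u ^+ 3 * y + (u ^+ 3 * wa1 W - wa1 W' * u ^+ 2) / 2%:R * x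
        + (u ^+ 3 * wa3 W - wa3 W' - wa1 W' * r) / 2%:R * z)
    + wa1 W' * (u ^+ 2 * x + r * z) + wa3 W' * z
  = u ^+ 3 * (2%:R * y + wa1 W * x + wa3 W * z) by field.
transitivity (u ^+ 6 * ((2%:R * y + wa1 W * x + wa3 W * z) ^+ 2 * z)).
  by ring.
rewrite e.
transitivity (4%:R * u ^+ 6 * x ^+ 3 + u ^+ 4 * (u ^+ 2 * wb2 W) * x ^+ 2 * z
  + 2%:R * u ^+ 2 * (u ^+ 4 * wb4 W) * x * z ^+ 2 + (u ^+ 6 * wb6 W) * z ^+ 3).
  by ring.
rewrite e2 e4 e6; ring.
Qed.
End ModelChange.

Section Isomorphism.
Variables (K : fieldType) (L : closedFieldType) (iota : {rmorphism K -> L}).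
Hypothesis n2 : 2%:R != 0 :> K.
Implicit Types E : ellcurve K.
Local Notation bc := (base_change iota).
Local Notation pt := {vspace 'rV[L]_3}.

Lemma model_change_map u r (W W' : weierstrass K) : model_change u r W W' ->
  model_change (iota u) (iota r) (map_weierstrass iota W) (map_weierstrass iota W').
Proof.
case=> u0 e2 e4 e6; split; first by rewrite fmorph_eq0.
all: rewrite !(wb2_map, wb4_map, wb6_map).
all: rewrite -?(rmorph_nat iota, rmorphXn, rmorphM, rmorphD).
- by rewrite e2.
- by rewrite e4.
- by rewrite e6.
Qed.

Definition change_pt u r E E' (P : pt) : pt :=
  <[change_map (iota u) (iota r) (bc E) (bc E') (vpick P)]>%VS.

Let n2L : 2%:R != 0 :> L.
Proof. by rewrite -(rmorph_nat iota) fmorph_eq0. Qed.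

Lemma change_pt_line u r E E' (v : 'rV[L]_3) : v != 0 ->
  change_pt u r E E' <[v]>%VS = <[change_map (iota u) (iota r) (bc E) (bc E') v]>%VS.
Proof.
move=> v0; have [k k0] := vpick_line v0.
by rewrite /change_pt => ->; rewrite change_map_scale line_scale.
Qed.

Lemma line_pick (P : pt) : \dim P = 1%N -> vpick P != 0 /\ P = <[vpick P]>%VS.
Proof.
move=> dP; have v0 : vpick P != 0 by rewrite vpick0 -dimv_eq0 dP.
by split=> //; apply: line_mem => //; exact: memv_pick.
Qed.

Lemma change_ptK u r E E' (P : pt) : u != 0 -> \dim P = 1%N ->
  change_pt u^-1 (- r / u ^+ 2) E' E (change_pt u r E E' P) = P.
Proof.
move=> u0 /line_pick[v0 PE]; have iu0 : iota u != 0 by rewrite fmorph_eq0.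
rewrite {1}PE (change_pt_line u r E E' v0) change_pt_line ?change_map_neq0 //.
by rewrite fmorph_div rmorphN rmorphXn fmorphV change_mapK.
Qed.

Lemma change_pt_morphism u r E E' : model_change u r E E' ->
  ell_morphism iota E E' (change_pt u r E E').
Proof.
move=> ch; have [u0 _ _ _] := ch; have chL := model_change_map ch.
have iu0 : iota u != 0 by rewrite fmorph_eq0.
split=> P [dP onP]; have [v0 PE] := line_pick dP.
  rewrite PE change_pt_line //; apply/points_line.
    exact: change_map_neq0.
  by apply: on_cubic_change => //; apply: onP; exact: memv_pick.
pose f (i : 'I_3) : {mpoly K[3]} := nth 0 [::
  u ^+ 2 *: 'X_0 + r *: 'X_2%:R;
  u ^+ 3 *: 'X_1 + ((u ^+ 3 * wa1 E - wa1 E' * u ^+ 2) / 2%:R) *: 'X_0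
        + ((u ^+ 3 * wa3 E - wa3 E' - wa1 E' * r) / 2%:R) *: 'X_2%:R;
  'X_2%:R] i.
have fE v : homog_eval iota f v = change_map (iota u) (iota r) (bc E) (bc E') v.
  apply/rowP => -[[|[|[|//]]] lti]; rewrite !mxE /f /=.
  - by rewrite rmorphD /= !map_mpolyZ !map_mpolyX mevalD !mevalZ !mevalXU rmorphXn.
  - rewrite !(raddfD (map_mpoly iota)) /= !map_mpolyZ !map_mpolyX.
    rewrite !mevalD !mevalZ !mevalXU.
    by rewrite !fmorph_div !(rmorph_nat, rmorphXn, rmorphM, rmorphB).
  - by rewrite map_mpolyX mevalXU.
exists 1%N, f; split.
- have X1 i : ('X_i : {mpoly K[3]}) \is 1.-homog by rewrite dhomogX /= mdeg1.
  by case=> -[|[|[|//]]] lti; rewrite /f /= ?dhomogD ?dhomogZ.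
- by exists (vpick P); [exact: memv_pick | rewrite fE change_map_neq0].
- move=> v [dv _] _; rewrite fE change_pt_line //.
  by move: dv; rewrite dim_vline; case: (v != 0).
Qed.

Lemma change_pt_origin u r E E' : u != 0 ->
  change_pt u r E E' (origin L) = origin L.
Proof.
move=> u0; rewrite /origin change_pt_line; last first.
  by apply/eqP => /rowP/(_ 1); rewrite !mxE; apply/eqP; exact: oner_neq0.
have iu0 : iota u ^+ 3 != 0 by rewrite expf_neq0 // fmorph_eq0.
rewrite -[RHS](line_scale _ iu0); congr (<[_]>%VS).
by apply/rowP => -[[|[|[|//]]] lti]; rewrite !mxE /= !mulr0 ?mulr1 ?addr0.
Qed.

Theorem iso_of_model_change u r E E' : model_change u r E E' ->
  ell_isomorphic iota E E'.
Proof.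
move=> ch; have [u0 _ _ _] := ch.
exists (change_pt u r E E'), (change_pt u^-1 (- r / u ^+ 2) E' E); split.
- exact: change_pt_morphism.
- exact/change_pt_morphism/model_change_sym.
- by move=> P [dP _]; exact: change_ptK.
- move=> P [dP _]; have e : - (- r / u ^+ 2) / u^-1 ^+ 2 = r.
    by rewrite exprVn invrK !mulNr opprK divfK // expf_neq0.
  have := @change_ptK u^-1 (- r / u ^+ 2) E' E P.
  by rewrite e invr_eq0 invrK; apply.
- exact: change_pt_origin.
Qed.
End Isomorphism.

(** * Powers and additive maps in a finite field *)

Section FiniteField.
Variables (F : finFieldType).

Lemma finField_generator : exists g : F,
  [/\ g != 0, (#|F|.-1).-primitive_root g
    & forall x, x != 0 -> exists k, x = g ^+ k].
Proof.
have F1 := finNzRing_gt1 F.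
have root1 (x : F) : x != 0 -> x ^+ #|F|.-1 = 1.
  move=> x0; apply: (mulfI x0).
  by rewrite -exprS prednK ?mulr1 ?expf_card // ltnW.
have /hasP[g g0 gP] : has (#|F|.-1).-primitive_root (enum [pred x : F | x != 0]).
  apply: has_prim_root.
  - by rewrite -ltnS prednK // ltnW.
  - by apply/allP => x; rewrite mem_enum inE => x0; apply/unity_rootP; exact: root1.
  - exact: enum_uniq.
  - rewrite -cardE -(cardC1 (0 : F)) leq_eqVlt; apply/orP; left.
    exact/eqP/eq_card.
exists g; split=> //; first by rewrite mem_enum inE in g0.
move=> x /root1 x1.
by have [i ->] := prim_rootP gP x1; exists i.
Qed.

(** The class of the exponent modulo m is well defined on F^* modulo m-th powers
    when m divides q - 1. *)
Lemma generator_power_mod m (g u : F) i j : (m %| #|F|.-1)%N ->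
  (#|F|.-1).-primitive_root g -> (forall x, x != 0 -> exists k, x = g ^+ k) ->
  u != 0 -> u ^+ m * g ^+ i = g ^+ j -> (i = j %[mod m])%N.
Proof.
move=> mq gP gen /gen[k ->]; rewrite -exprM -exprD => /eqP.
rewrite (eq_prim_root_expr gP) => /eqP/(congr1 (modn^~ m)).
by rewrite /= !modn_dvdm // modnMDl.
Qed.

Hypothesis three0 : 3%:R = 0 :> F.

Definition artin_schreier (t : F) := t ^+ 3 - t.
Local Notation wp := artin_schreier.

Lemma cube_add (x y : F) : (x + y) ^+ 3 = x ^+ 3 + y ^+ 3.
Proof.
transitivity (x ^+ 3 + y ^+ 3 + 3%:R * (x ^+ 2 * y + x * y ^+ 2)); first by ring.
by rewrite three0 mul0r addr0.
Qed.

Lemma artin_schreierD x y : wp (x + y) = wp x + wp y.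
Proof. by rewrite /wp cube_add; ring. Qed.

Lemma artin_schreierN x : wp (- x) = - wp x.
Proof. by rewrite /wp; ring. Qed.

(** The map is additive, and a nonzero r in its kernel would satisfy r^2 = s. *)
Lemma nonsquare_surjective (s : F) : (forall x, s <> x ^+ 2) ->
  forall c, exists r, c = r ^+ 3 - s * r.
Proof.
move=> sN c; pose f r := r ^+ 3 - s * r.
have /injF_bij[h _ fK] : injective f.
  move=> x y fxy; apply/eqP; rewrite -subr_eq0; apply/negPn/negP => d0.
  have : f (x - y) = 0 
    by rewrite -(subrr (f y)) -{1}fxy /f cube_add; ring.
  rewrite /f => e; apply: (sN (x - y)); apply: (mulIf d0).
  by apply/esym/subr0_eq; rewrite -e; ring.
by exists (h c); rewrite -{1}(fK c).
Qed.

(** The kernel of t -> t^3 - t is {0, 1, -1}, so its image A is a proper subgroup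
    with at least q / 3 elements.  For d outside A the cosets A, A + d and
    A - d are disjoint, hence they cover the field. *)
Lemma artin_schreier_cokernel : exists d, (forall t, d <> wp t) /\
  forall c, exists t e, [\/ e = 0, e = 1 | e = -1] /\ c = wp t + e * d.
Proof.
have n11 : (1 : F) != -1.
  rewrite -subr_eq0; apply/negP => /eqP e; case/eqP: (oner_neq0 F).
  by transitivity (3%:R - (1 - -1) : F); [ring | rewrite e three0 subr0].
pose A := [set wp t | t in [set: F]]; pose K := [set (0 : F); 1; -1].
have cardK : #|K| = 3%N.
  rewrite /K -finset.setUA cardsU1 cards2 !inE n11 eq_sym oner_eq0 eq_sym oppr_eq0.
  by rewrite oner_eq0.
have kerE t t' : wp t = wp t' -> t - t' \in K.
  move=> e; have : wp (t - t') = 0.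
    by rewrite artin_schreierD artin_schreierN e subrr.
  move: (t - t') => z.
  have -> : wp z = z * ((z - 1) * (z - -1)) by rewrite /wp; ring.
  by move/eqP; rewrite !mulf_eq0 !subr_eq0 /K !inE orbA.
have [d dA] : exists d, d \notin A.
  apply/existsP; rewrite -[[exists _, _]]negbK negb_exists.
  apply/negP => /forallP AT.
  have AE : #|A| == #|[set: F]|.
    by apply/eqP/eq_card => x; rewrite !inE -[LHS]negbK AT.
  have /imset_injP inj := AE.
  have : (0 : F) = 1 by apply: inj; rewrite ?inE // /wp; ring.
  by move/eqP; rewrite eq_sym oner_eq0.
exists d; split.
  by move=> t dt; case/negP: dA; apply/imsetP; exists t.
(* A section of the map: (y, e) -> sec y + e is onto, which bounds #|F|. *)
pose sec y := odflt 0 [pick t | wp t == y].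
have secK t : wp (sec (wp t)) = wp t.
  by rewrite /sec; case: pickP => [x /eqP //|/(_ t)]; rewrite eqxx.
have cardA : (#|F| <= #|A| * 3)%N.
  rewrite -cardK -cardsX.
  apply: leq_trans (leq_imset_card (fun p : F * F => sec p.1 + p.2) _).
  rewrite -cardsT; apply/subset_leq_card/fintype.subsetP => t _.
  apply/imsetP; exists (wp t, t - sec (wp t)); last by rewrite /= addrC subrK.
  by apply/setXP; split; [exact: imset_f | exact/kerE/esym/secK].
pose G (p : F * F) := p.1 + p.2 * d.
have injG : {in finset.setX A K &, injective G}.
  move=> [y e] [y' e'] /setXP[/imsetP[t _ /= ->] eK] /setXP[/imsetP[t' _ /= ->] eK'].
  rewrite /G /= => E; have {}E : wp (t - t') = (e' - e) * d.
    rewrite artin_schreierD artin_schreierN mulrBl.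
    by apply/eqP; rewrite subr_eq addrAC eq_sym subr_eq addrC -E addrC.
  have ee : e' - e \in K.
    have two : 1 + 1 = -1 :> F by apply/subr0_eq; rewrite -three0; ring.
    have two' : -1 - 1 = 1 :> F by rewrite -opprD two opprK.
    move: eK eK'; rewrite /K !inE -!orbA => /or3P[]/eqP-> /or3P[]/eqP->;
      by rewrite ?(subrr, subr0, sub0r, opprK) ?two ?two' eqxx ?orbT.
  move: ee; rewrite /K !inE -orbA => /or3P[]/eqP e0.
  - move: E; rewrite e0 mul0r => E; congr (_, _); last exact/esym/subr0_eq.
    by apply/subr0_eq; rewrite -artin_schreierN -artin_schreierD.
  - case/negP: dA; apply/imsetP; exists (t - t') => //.
    by rewrite E e0 mul1r.
  - case/negP: dA; apply/imsetP; exists (- (t - t')) => //.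
    by rewrite artin_schreierN E e0 mulN1r opprK.
have imT : G @: finset.setX A K = [set: F].
  by apply/eqP; rewrite eqEcard finset.subsetT cardsT card_in_imset // cardsX cardK.
move=> c; have : c \in G @: finset.setX A K by rewrite imT inE.
case/imsetP=> -[y e]; rewrite /K !inE /= => /andP[/imsetP[t _ ->] eK] ->.
exists t, e; split=> //.
by case/orP: eK => [/orP[]|] /eqP; [constructor 1|constructor 2|constructor 3].
Qed.
End FiniteField.

(** * Twists as classes of Weierstrass equations *)

Lemma frobenius_power (R : comNzRingType) p n : p \in [pchar R] ->
  exists s : {rmorphism R -> R}, forall x, s x = x ^+ (p ^ n).
Proof.
move=> pR; elim: n => [|n [s sE]].
  by exists (idfun : {rmorphism R -> R}) => x; rewrite expr1.
exists (pFrobenius_aut pR \o s : {rmorphism R -> R}) => x /=.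
by rewrite pFrobenius_autE sE -exprM expnSr.
Qed.

(** The polynomial X^q - X has no roots other than the elements of F_q. *)
Lemma frobenius_fixed (F : finFieldType) (L : fieldType)
    (iota : {rmorphism F -> L}) z :
  z ^+ #|F| = z -> exists a, z = iota a.
Proof.
move=> zq; have := congr1 (fun p : {poly L} => p.[z])
  (congr1 (map_poly iota) (finField_genPoly F)).
rewrite rmorphB /= map_polyXn map_polyX hornerD hornerN hornerXn hornerX.
rewrite zq subrr rmorph_prod horner_prod => /esym/eqP.
rewrite prodf_seq_eq0 => /hasP[a _].
rewrite /= rmorphB /= map_polyX map_polyC hornerXsubC subr_eq0 => /eqP.
by exists a.
Qed.

Section Char3.
Variable F : fieldType.
Hypothesis three0 : 3%:R = 0 :> F.
Implicit Types W : weierstrass F.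

Lemma two_neq0 : 2%:R != 0 :> F.
Proof.
apply/eqP => e; case/eqP: (oner_neq0 F).
by transitivity (3%:R - 2%:R : F); [ring | rewrite e three0 subr0].
Qed.

Lemma model_change3 u r W W' : model_change u r W W' <->
  [/\ u != 0, u ^+ 2 * wb2 W = wb2 W', u ^+ 4 * wb4 W = wb4 W' + r * wb2 W'
    & u ^+ 6 * wb6 W = wb6 W' - r * wb4 W' + r ^+ 2 * wb2 W' + r ^+ 3].
Proof.
have E2 : wb2 W' + 12%:R * r = wb2 W' + 3%:R * (4%:R * r) by ring.
have E4 : wb4 W' + r * wb2 W' + 6%:R * r ^+ 2 =
  wb4 W' + r * wb2 W' + 3%:R * (2%:R * r ^+ 2) by ring.
have E6 : wb6 W' + 2%:R * r * wb4 W' + r ^+ 2 * wb2 W' + 4%:R * r ^+ 3 =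
  wb6 W' - r * wb4 W' + r ^+ 2 * wb2 W' + r ^+ 3 +
  3%:R * (r * wb4 W' + r ^+ 3) by ring.
by rewrite /model_change E2 E4 E6 three0 !mul0r !addr0.
Qed.

Lemma wdisc3 W :
  wdisc W = wb2 W ^+ 2 * wb4 W ^+ 2 - wb2 W ^+ 3 * wb6 W + wb4 W ^+ 3.
Proof.
transitivity (wb2 W ^+ 2 * wb4 W ^+ 2 - wb2 W ^+ 3 * wb6 W + wb4 W ^+ 3
  + 3%:R * (wb2 W ^+ 2 * wb8 W - 3%:R * wb4 W ^+ 3 - 9%:R * wb6 W ^+ 2
            + 3%:R * wb2 W * wb4 W * wb6 W)).
  by rewrite /wdisc /wb2 /wb4 /wb6 /wb8; ring.
by rewrite three0 mul0r addr0.
Qed.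

Lemma jinv3_eq0 (E : ellcurve F) : (jinv E == 0) = (wb2 E == 0).
Proof.
rewrite /jinv mulf_eq0 invr_eq0 (negPf (ell_nonsing E)) orbF expf_eq0 /=.
rewrite /wc4 (_ : 24%:R * wb4 E = 3%:R * (8%:R * wb4 E)); last by ring.
by rewrite three0 mul0r subr0 expf_eq0.
Qed.

(** The model is y^2 = x^3 + a x^2 - b x + c: modulo 3 its b2, b4, b6 are
    4a = a, -2b = b and 4c = c. *)
Lemma exists_curve3 a b c : a ^+ 2 * b ^+ 2 - a ^+ 3 * c + b ^+ 3 != 0 ->
  exists E : ellcurve F, [/\ wb2 E = a, wb4 E = b & wb6 E = c].
Proof.
move=> d; pose W := Weierstrass 0 a 0 (- b) c.
have E2 : wb2 W = a.
  transitivity (a + 3%:R * a); first by rewrite /wb2 /=; ring.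
  by rewrite three0 mul0r addr0.
have E4 : wb4 W = b.
  transitivity (b - 3%:R * b); first by rewrite /wb4 /=; ring.
  by rewrite three0 mul0r subr0.
have E6 : wb6 W = c.
  transitivity (c + 3%:R * c); first by rewrite /wb6 /=; ring.
  by rewrite three0 mul0r addr0.
have dW : wdisc W != 0 by rewrite wdisc3 E2 E4 E6.
by exists (EllCurve dW).
Qed.
End Char3.

Section TwistsOverFiniteField.
Variables (n : nat) (Fq : finFieldType) (L : closedFieldType).
Variable iota : {rmorphism Fq -> L}.
Hypothesis card_Fq : #|Fq| = (3 ^ n)%N.
Implicit Types E : ellcurve Fq.
Local Notation bc := (base_change iota).

Let three0 : 3%:R = 0 :> Fq.
Proof. exact: pcharf0 (card_finPcharP card_Fq isT). Qed.

Let three0L : 3%:R = 0 :> L.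
Proof. by rewrite -(rmorph_nat iota) three0 rmorph0. Qed.

Definition equivalent E E' := exists u r : Fq, model_change u r E E'.

Lemma equivalent_refl E : equivalent E E.
Proof. by exists 1, 0; exact: model_change_refl. Qed.
Lemma equivalent_sym E E' : equivalent E E' -> equivalent E' E.
Proof. by case=> u [r] /model_change_sym; do 2!eexists; eassumption. Qed.
Lemma equivalent_trans E E' E'' :
  equivalent E E' -> equivalent E' E'' -> equivalent E E''.
Proof.
move=> [u [r h]] [u' [r' h']]; do 2!eexists.
exact: model_change_trans h h'.
Qed.

Lemma iso_equivalent E E' : ell_isomorphic iota E E' <-> equivalent E E'.
Proof.
split=> [|[u [r]]]; last exact/iso_of_model_change/two_neq0.
case/(iso_model_change (two_neq0 three0L)) => u [r [ch fixed]].
have pL : 3%N \in [pchar L] by rewrite inE /= three0L eqxx.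
have [s sE] := frobenius_power n pL.
have [|su sr] := fixed s.
  by move=> a; rewrite sE -card_Fq -rmorphXn expf_card.
have [a ua] : exists a, u = iota a by apply: frobenius_fixed; rewrite card_Fq -sE.
have [b rb] : exists b, r = iota b by apply: frobenius_fixed; rewrite card_Fq -sE.
exists a, b; move: ch; rewrite {}ua {}rb => -[u0 e2 e4 e6].
rewrite !(wb2_map, wb4_map, wb6_map) in e2 e4 e6.
rewrite -?(rmorph_nat iota, rmorphXn, rmorphM, rmorphD) in e2 e4 e6.
split; first by rewrite fmorph_eq0 in u0.
- exact: fmorph_inj e2.
- exact: fmorph_inj e4.
- exact: fmorph_inj e6.
Qed.

Definition geom_equivalent E E' := exists u r : L, model_change u r (bc E) (bc E').

Lemma twist_equivalent E E' : is_twist iota E E' <-> geom_equivalent E' E.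
Proof.
split=> [|[u [r ch]]].
  by case/(iso_model_change (two_neq0 three0L)) => u [r [ch _]]; exists u, r.
exact: (@iso_of_model_change L L idfun (two_neq0 three0L) u r (bc E') (bc E) ch).
Qed.

Lemma equivalent_geom E E' : equivalent E E' -> geom_equivalent E E'.
Proof. by case=> u [r ch]; exists (iota u), (iota r); exact: model_change_map. Qed.
Lemma geom_equivalent_trans E E' E'' :
  geom_equivalent E E' -> geom_equivalent E' E'' -> geom_equivalent E E''.
Proof.
move=> [u [r h]] [u' [r' h']]; do 2!eexists.
exact: model_change_trans h h'.
Qed.
Lemma geom_equivalent_sym E E' : geom_equivalent E E' -> geom_equivalent E' E.
Proof. by case=> u [r] /model_change_sym; do 2!eexists; eassumption. Qed.

Lemma card_Twist_of_representatives E (k : nat) (e : nat -> ellcurve Fq) :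
  (forall i, (i < k)%N -> geom_equivalent (e i) E) ->
  (forall i j, (i < j < k)%N -> ~ equivalent (e i) (e j)) ->
  (forall E', geom_equivalent E' E -> exists2 i, (i < k)%N & equivalent (e i) E') ->
  (Twist iota E #= `I_k)%card.
Proof.
move=> tw dist exh.
pose cl i : set (ellcurve Fq) := [set E'' | ell_isomorphic iota (e i) E'']%classic.
have -> : Twist iota E = (cl @` `I_k)%classic.
  apply/seteqP; split=> C /=.
    case=> E' /twist_equivalent/exh[i ik eq] ->; exists i => //.
    apply/seteqP; split=> E'' /= /iso_equivalent h; apply/iso_equivalent.
      exact: equivalent_trans (equivalent_sym eq) h.
    exact: equivalent_trans eq h.
  by case=> i ik <-; exists (e i) => //; apply/twist_equivalent; exact: tw.
apply: inj_card_eq => i j; rewrite !inE /= => ik jk clij.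
have eqij : equivalent (e i) (e j).
  apply/iso_equivalent; have : cl j (e j).
    by apply/iso_equivalent; exact: equivalent_refl.
  by rewrite -clij.
case: (ltngtP i j) => // ij; [case: (@dist i j) | case: (@dist j i)].
- by rewrite ij.
- exact: eqij.
- by rewrite ij.
- exact: equivalent_sym.
Qed.

Lemma pow3_mod4 k : (3 ^ k %% 4 = if odd k then 3 else 1)%N.
Proof. by elim: k => // k IHk; rewrite expnS -modnMmr IHk /=; case: odd. Qed.

Lemma sqrt_closed (x : L) : exists y, y ^+ 2 = x.
Proof. by have [y] := curve_point 'X x; rewrite hornerX; exists y. Qed.

Lemma curve_disc E :
  wb2 E ^+ 2 * wb4 E ^+ 2 - wb2 E ^+ 3 * wb6 E + wb4 E ^+ 3 != 0.
Proof. by rewrite -(wdisc3 three0) ell_nonsing. Qed.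

Lemma geom_equivalent3 E E' : geom_equivalent E E' <-> exists u r : L,
  [/\ u != 0, u ^+ 2 * iota (wb2 E) = iota (wb2 E'),
      u ^+ 4 * iota (wb4 E) = iota (wb4 E') + r * iota (wb2 E')
    & u ^+ 6 * iota (wb6 E) = iota (wb6 E') - r * iota (wb4 E')
        + r ^+ 2 * iota (wb2 E') + r ^+ 3].
Proof.
split=> -[u [r h]]; exists u, r.
  by move/(model_change3 three0L): h; rewrite !(wb2_map, wb4_map, wb6_map).
by apply/(model_change3 three0L); rewrite !(wb2_map, wb4_map, wb6_map).
Qed.

Lemma geom_wb2_eq0 E E' : geom_equivalent E E' -> (wb2 E == 0) = (wb2 E' == 0).
Proof.
move/geom_equivalent3 => [u [r [u0 e2 _ _]]].
by rewrite -!(fmorph_eq0 iota) -e2 mulf_eq0 expf_eq0 (negPf u0).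
Qed.

(** * Curves with nonzero j-invariant *)

Section Ordinary.

Lemma normal_form E : wb2 E != 0 -> exists E0,
  [/\ equivalent E E0, wb2 E0 = wb2 E & wb4 E0 = 0].
Proof.
move=> a0; pose r := wb4 E / wb2 E.
have [|E0 [E2 E4 E6]] := @exists_curve3 Fq three0 (wb2 E) 0
    (wb6 E - r ^+ 2 * wb2 E - r ^+ 3).
  by have := curve_disc E; congr (_ != _); rewrite /r; field.
exists E0; split=> //; exists 1, r; apply/(model_change3 three0).
rewrite E2 E4 E6 oner_neq0; split=> //; last by ring.
  by ring.
by rewrite /r; field.
Qed.

(** Between curves with b4 = 0 the shift r must be 0, so b6 / b2^3 is
    preserved. *)
Lemma normal_form_invariant E E' : wb2 E != 0 -> wb4 E = 0 -> wb4 E' = 0 ->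
  geom_equivalent E' E -> wb6 E' * wb2 E ^+ 3 = wb6 E * wb2 E' ^+ 3.
Proof.
move=> a0 b0 b0' /geom_equivalent3[u [r [u0 e2 e4 e6]]].
have r0 : r = 0.
  apply/eqP; move/esym/eqP: e4; rewrite b0 b0' rmorph0 mulr0 add0r mulf_eq0.
  by rewrite fmorph_eq0 (negPf a0) orbF.
apply: (fmorph_inj iota); rewrite !(rmorphXn, rmorphM) -e2.
have -> : iota (wb6 E) = u ^+ 6 * iota (wb6 E') by rewrite e6 b0 r0; ring.
by ring.
Qed.

Lemma normal_form_equivalent E E' u : wb2 E != 0 -> u != 0 ->
  wb4 E = 0 -> wb4 E' = 0 -> u ^+ 2 * wb2 E = wb2 E' ->
  wb6 E' * wb2 E ^+ 3 = wb6 E * wb2 E' ^+ 3 -> equivalent E E'.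
Proof.
move=> a0 u0 b0 b0' e2 e6; exists u, 0; apply/(model_change3 three0).
split=> //; rewrite ?b0 ?b0'; try by ring.
apply: (mulIf (expf_neq0 3 a0)).
transitivity (wb6 E * wb2 E' ^+ 3); first by rewrite -e2; ring.
by rewrite -e6; ring.
Qed.

Lemma card_Twist_ordinary E : wb2 E != 0 -> (Twist iota E #= `I_2)%card.
Proof.
move=> a0; have [E0 [EE0 E0a E0b]] := normal_form a0.
have a00 : wb2 E0 != 0 by rewrite E0a.
have [g [g0 gP gen]] := finField_generator Fq.
have q1 : (2 %| #|Fq|.-1)%N.
  by rewrite card_Fq; have := pow3_mod4 n; case: odd; lia.
have [|Eg [Ea Eb Ec]] := @exists_curve3 Fq three0 (g * wb2 E0) 0 (g ^+ 3 * wb6 E0).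
  have := mulf_neq0 (expf_neq0 6 g0) (curve_disc E0); rewrite E0b.
  by congr (_ != _); ring.
have Eg0 : geom_equivalent Eg E0.
  have [u u2] := sqrt_closed (iota g); apply/geom_equivalent_sym/geom_equivalent3.
  exists u, 0; rewrite Ea Eb Ec E0b !(rmorphXn, rmorphM) -u2; split; try by ring.
  by apply: contraNneq g0 => u0; rewrite -(fmorph_eq0 iota) -u2 u0 expr0n.
have EE0g := equivalent_geom EE0.
apply: (@card_Twist_of_representatives _ _ (fun i => if i == 0%N then E0 else Eg)).
- move=> [|[|//]] _ /=; first exact: geom_equivalent_sym.
  exact: geom_equivalent_trans Eg0 (geom_equivalent_sym EE0g).
- move=> i j ij; have [-> ->] : i = 0%N /\ j = 1%N by lia.
  move=> /= [u [r /(model_change3 three0)[u0 e2 _ _]]].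
  have : u ^+ 2 * g ^+ 0 = g ^+ 1.
    by apply: (mulIf a00); rewrite expr0 expr1 mulr1 e2.
  by move/(generator_power_mod q1 gP gen u0).
move=> E' EE'; have a0' : wb2 E' != 0 by rewrite (geom_wb2_eq0 EE').
have [E0' [EE0' E0a' E0b']] := normal_form a0'.
have inv : wb6 E0' * wb2 E0 ^+ 3 = wb6 E0 * wb2 E0' ^+ 3.
  apply: normal_form_invariant => //.
  apply: geom_equivalent_trans (equivalent_geom (equivalent_sym EE0')) _.
  exact: geom_equivalent_trans EE' EE0g.
have [k gk] : exists k, wb2 E0' / wb2 E0 = g ^+ k.
  by apply: gen; rewrite mulf_neq0 ?invr_eq0 // E0a'.
have {}gk : g ^+ k * wb2 E0 = wb2 E0' by rewrite -gk divfK.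
have gm0 m : g ^+ m != 0 by rewrite expf_neq0.
have [m km] : exists m, k = (odd k + m.*2)%N.
  by exists k./2; rewrite odd_double_half.
case ok: (odd k) km => km.
- exists 1%N => //=; apply: equivalent_trans (equivalent_sym EE0').
  apply: (@normal_form_equivalent _ _ (g ^+ m)); rewrite ?Ea ?Eb ?Ec ?mulf_neq0 //.
    by rewrite -gk km -muln2 exprD exprM; ring.
  transitivity (g ^+ 3 * (wb6 E0' * wb2 E0 ^+ 3)); [ring | rewrite inv; ring].
- exists 0%N => //=; apply: equivalent_trans (equivalent_sym EE0').
  apply: (@normal_form_equivalent _ _ (g ^+ m)) => //.
  by rewrite -gk km -muln2 add0n exprM.
Qed.
End Ordinary.

(** * Curves with j-invariant zero *)

Section Supersingular.

Lemma equivalent_wb2_eq0 E E' : wb2 E = 0 -> wb2 E' = 0 ->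
  equivalent E E' <-> exists u r, [/\ u != 0, u ^+ 4 * wb4 E = wb4 E'
    & u ^+ 6 * wb6 E = wb6 E' - r * wb4 E' + r ^+ 3].
Proof.
move=> a0 a0'; split=> -[u [r]].
  move/(model_change3 three0); rewrite a0 a0' !mulr0 !addr0 => -[u0 _ e4 e6].
  by exists u, r.
case=> u0 e4 e6; exists u, r; apply/(model_change3 three0).
by rewrite a0 a0' !mulr0 !addr0.
Qed.

Lemma wb4_neq0 E : wb2 E = 0 -> wb4 E != 0.
Proof.
move=> a0; have := curve_disc E; rewrite a0; apply: contraNneq => ->.
by apply/eqP; ring.
Qed.

Lemma supersingular_geom_equivalent E E' : wb2 E = 0 -> wb2 E' = 0 ->
  geom_equivalent E E'.
Proof.
move=> a0 a0'; have b0 := wb4_neq0 a0; have b0' := wb4_neq0 a0'.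
have [v vE] := sqrt_closed (iota (wb4 E' / wb4 E)).
have [u uE] := sqrt_closed v.
have u4 : u ^+ 4 * iota (wb4 E) = iota (wb4 E').
  by rewrite (exprM u 2 2) uE vE -rmorphM divfK.
have [r rE] := @solve_monicpoly L 3 (fun i =>
  if i == 0%N then u ^+ 6 * iota (wb6 E) - iota (wb6 E')
  else if i == 1%N then iota (wb4 E') else 0) isT.
apply/geom_equivalent3; exists u, r; rewrite a0 a0' rmorph0 !mulr0 !addr0.
split=> //.
  apply: contraNneq b0' => u0.
  by rewrite -(fmorph_eq0 iota) -u4 u0 expr0n mul0r.
by rewrite rE !big_ord_recr big_ord0 /=; ring.
Qed.

Lemma exists_curves0 : exists C : Fq -> Fq -> ellcurve Fq, forall b c, b != 0 ->
  [/\ wb2 (C b c) = 0, wb4 (C b c) = b & wb6 (C b c) = c].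
Proof.
have ex b c : b != 0 ->
    exists E : ellcurve Fq, [/\ wb2 E = 0, wb4 E = b & wb6 E = c].
  move=> b0; apply: exists_curve3 => //.
  by rewrite !expr0n !mul0r subr0 add0r expf_neq0.
have [E1 _] := ex 1 0 (oner_neq0 _).
have : forall p : Fq * Fq, exists E : ellcurve Fq, p.1 != 0 ->
    [/\ wb2 E = 0, wb4 E = p.1 & wb6 E = p.2].
  case=> b c /=; have [b0|b0] := eqVneq b 0; first by exists E1.
  by have [E EP] := ex b c b0; exists E.
by case/choice => C CP; exists (fun b c => C (b, c)) => b c; apply: (CP (b, c)).
Qed.

(** g generates the multiplicative group, and d generates the cokernel of
    t -> t^3 - t. *)
Variables (g d : Fq).
Hypotheses (g0 : g != 0) (gP : (#|Fq|.-1).-primitive_root g).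
Hypothesis gen : forall x : Fq, x != 0 -> exists k, x = g ^+ k.
Hypothesis d_notin : forall t, d <> artin_schreier t.
Hypothesis cokernel : forall c : Fq, exists t e,
  [\/ e = 0, e = 1 | e = -1] /\ c = artin_schreier t + e * d.

Lemma power_mod_equivalent m i j E E' : (m %| #|Fq|.-1)%N -> (m %| 4)%N ->
  wb2 E = 0 -> wb2 E' = 0 -> wb4 E = g ^+ i -> wb4 E' = g ^+ j ->
  equivalent E E' -> (i = j %[mod m])%N.
Proof.
move=> mq m4 a0 a0' bE bE' /(equivalent_wb2_eq0 a0 a0')[u [r [u0 e4 _]]].
have := e4; rewrite bE bE' -(divnK m4) exprM => /(generator_power_mod mq gP gen).
by apply; rewrite expf_neq0.
Qed.

Lemma nonsquare_equivalent i u E E' : (2 %| #|Fq|.-1)%N -> odd i -> u != 0 ->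
  wb2 E = 0 -> wb2 E' = 0 -> wb4 E = g ^+ i -> wb6 E = 0 ->
  wb4 E' = u ^+ 4 * g ^+ i -> equivalent E E'.
Proof.
move=> q1 oi u0 a0 a0' bE cE bE'.
have [|r rE] := nonsquare_surjective three0 (s := wb4 E') _ (- wb6 E').
  move=> x xE; have x0 : x != 0.
    by apply: contraNneq (wb4_neq0 a0') => x0; rewrite xE x0 expr0n.
  have := generator_power_mod (u := u ^+ 2 / x) (i := i) (j := 0) q1 gP gen.
  rewrite mulf_neq0 ?invr_eq0 ?expf_neq0 // => /(_ isT); rewrite modn2 oi.
  suff -> : (u ^+ 2 / x) ^+ 2 * g ^+ i = g ^+ 0 by move/(_ erefl).
  by rewrite expr_div_n -exprM mulrAC -bE' xE divff // expf_neq0.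
apply/equivalent_wb2_eq0 => //; exists u, r; split=> //.
  by rewrite bE mulrC bE' mulrC.
by rewrite cE mulr0 -(subrr (wb6 E')) rE; ring.
Qed.

(** With k = u^2 h the coset of b6 / k^3 modulo the image of t -> t^3 - t decides
    which representative is reached. *)
Lemma square_equivalent h u E' : h != 0 -> u != 0 -> wb2 E' = 0 ->
  wb4 E' = u ^+ 4 * h ^+ 2 -> exists2 e, [\/ e = 0, e = 1 | e = -1] &
  forall E, wb2 E = 0 -> wb4 E = h ^+ 2 -> wb6 E = e * (h ^+ 3 * d) ->
    equivalent E E'.
Proof.
move=> h0 u0 a0' bE'; pose k := u ^+ 2 * h.
have k0 : k != 0 by rewrite mulf_neq0 ?expf_neq0.
have [t [e [eP cE]]] := cokernel (wb6 E' / k ^+ 3).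
exists e => // E a0 bE cE0; apply/equivalent_wb2_eq0 => //; exists u, (- k * t).
split=> //; first by rewrite bE.
have {}cE : wb6 E' = k ^+ 3 * (artin_schreier t + e * d).
  by rewrite -cE mulrC divfK // expf_neq0.
by rewrite cE0 cE bE' /artin_schreier /k; ring.
Qed.

(** An isomorphism keeps b4 = h^2, so u^4 = 1, and u^6 = u^2 = 1 or -1 acts on the
    cosets by a sign. *)
Lemma square_equivalent_inv h e e' E E' : h != 0 ->
  wb2 E = 0 -> wb2 E' = 0 -> wb4 E = h ^+ 2 -> wb4 E' = h ^+ 2 ->
  wb6 E = e * (h ^+ 3 * d) -> wb6 E' = e' * (h ^+ 3 * d) -> equivalent E E' ->
  exists u t, [/\ u != 0, u ^+ 2 = 1 \/ u ^+ 2 = -1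
    & (u ^+ 2 * e - e') * d = artin_schreier t].
Proof.
move=> h0 a0 a0' bE bE' cE cE' /(equivalent_wb2_eq0 a0 a0')[u [r [u0]]].
rewrite bE bE' cE cE' => e4 e6.
have u4 : u ^+ 2 ^+ 2 = 1.
  by apply: (mulIf (expf_neq0 2 h0)); rewrite mul1r -exprM.
exists u, (r / h); split=> //.
  have /eqP := u4; rewrite -subr_eq0 -[X in _ - X](expr1n _ 2) subr_sqr mulf_eq0.
  by rewrite subr_eq0 addr_eq0 => /orP[]/eqP; [left | right].
apply: (mulfI (expf_neq0 3 h0)).
have u6 : u ^+ 6 = u ^+ 2 by rewrite (exprM u 2 3) exprS u4 mulr1.
rewrite u6 in e6.
transitivity (u ^+ 2 * (e * (h ^+ 3 * d)) - e' * (h ^+ 3 * d)); first by ring.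
by rewrite e6 /artin_schreier; field.
Qed.

Lemma opp_d_notin t : - d <> artin_schreier t.
Proof. by move=> e; apply: (@d_notin (- t)); rewrite artin_schreierN -e opprK. Qed.

(** Here q - 1 is 2 modulo 4, so u^(q-1) = u^2 whenever u^4 = 1. *)
Lemma no_sqrt_opp1 (u : Fq) : odd n -> u ^+ 2 <> -1.
Proof.
move=> on u2; have q4 : (3 ^ n %% 4 = 3)%N by rewrite pow3_mod4 on.
have u0 : u != 0.
  apply/eqP => u0; case/eqP: (oner_neq0 Fq).
  by rewrite -[RHS]oppr0 -[1]opprK -u2 u0 expr0n.
have : u ^+ (3 ^ n).-1 = 1.
  apply: (mulfI u0); rewrite -exprS prednK ?expn_gt0 // -card_Fq mulr1.
  exact: expf_card.
have -> : (3 ^ n).-1 = (4 * (3 ^ n %/ 4) + 2)%N by lia.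
rewrite exprD exprM (exprM u 2 2) u2 sqrrN expr1n expr1n mul1r => /eqP.
by rewrite eq_sym -subr_eq0 opprK; exact/negP/two_neq0.
Qed.

(** The exponent q - 1 is a multiple of 4, and g^((q-1)/4) has order 4. *)
Lemma exists_sqrt_opp1 : ~~ odd n -> (0 < n)%N -> exists u : Fq, u ^+ 2 = -1.
Proof.
move=> on n0; have q4 : (3 ^ n %% 4 = 1)%N by rewrite pow3_mod4 (negPf on).
have q3 : (3 ^ 1 <= 3 ^ n)%N by rewrite leq_pexp2l.
set q := (3 ^ n)%N in q4 q3; pose m := (q %/ 4)%N.
have qE : (#|Fq|.-1 = m * 4)%N by rewrite card_Fq -/q; lia.
exists (g ^+ m); rewrite -exprM.
have /eqP : (g ^+ (m * 2)) ^+ 2 = 1.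
  by rewrite -exprM -mulnA -qE; exact: prim_expr_order gP.
rewrite -[X in _ == X](expr1n _ 2) eqf_sqr => /orP[|/eqP //].
rewrite -(prim_order_dvd gP) qE gtnNdvd //; lia.
Qed.

Section Representatives.
Variable C : Fq -> Fq -> ellcurve Fq.
Hypothesis CP : forall b c, b != 0 ->
  [/\ wb2 (C b c) = 0, wb4 (C b c) = b & wb6 (C b c) = c].

(** The representatives with b4 a square h^2, one for each coset e d, and those
    with b4 = g^i and b6 = 0, which serve for odd i. *)
Let sq_curve h e := C (h ^+ 2) (e * (h ^+ 3 * d)).
Let pow_curve i := C (g ^+ i) 0.

Let sq_curveP h e : h != 0 ->
  [/\ wb2 (sq_curve h e) = 0, wb4 (sq_curve h e) = h ^+ 2
    & wb6 (sq_curve h e) = e * (h ^+ 3 * d)].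
Proof. by move=> h0; apply: CP; rewrite expf_neq0. Qed.

Let pow_curveP i :
  [/\ wb2 (pow_curve i) = 0, wb4 (pow_curve i) = g ^+ i & wb6 (pow_curve i) = 0].
Proof. by apply: CP; rewrite expf_neq0. Qed.

Lemma card_Twist_supersingular_odd E : odd n -> wb2 E = 0 ->
  (Twist iota E #= `I_4)%card.
Proof.
move=> on aE; have q4 : (3 ^ n %% 4 = 3)%N by rewrite pow3_mod4 on.
have q1 : (2 %| #|Fq|.-1)%N by rewrite card_Fq; lia.
have n10 := oner_neq0 Fq.
have sq_pow_neq e : ~ equivalent (sq_curve 1 e) (pow_curve 1).
  have [a b _] := sq_curveP e n10; have [a' b' _] := pow_curveP 1.
  have b0 : wb4 (sq_curve 1 e) = g ^+ 0 by rewrite b expr1n.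
  by move/(power_mod_equivalent q1 isT a a' b0 b')/eqP.
have sq_eq e e' : equivalent (sq_curve 1 e) (sq_curve 1 e') ->
    exists t, (e - e') * d = artin_schreier t.
  have [a b c] := sq_curveP e n10; have [a' b' c'] := sq_curveP e' n10.
  case/(square_equivalent_inv n10 a a' b b' c c') => u [t [_ u2 tE]].
  exists t; rewrite -tE; by case: u2 => [->|/(no_sqrt_opp1 on)//]; rewrite mul1r.
apply: (@card_Twist_of_representatives _ _ 
  (nth (pow_curve 1) [:: sq_curve 1 0; sq_curve 1 1; sq_curve 1 (-1)])).
- move=> i _; apply: supersingular_geom_equivalent => //.
  case: i => [|[|[|i]]] /=; rewrite ?nth_nil;
    by [case: (sq_curveP 0 n10) | case: (sq_curveP 1 n10)
      | case: (sq_curveP (-1) n10) | case: (pow_curveP 1)].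
- move=> [|[|[|i]]] [|[|[|[|j]]]] ij; try lia; rewrite /=; try exact: sq_pow_neq.
  + by case/sq_eq => t; rewrite sub0r mulN1r; exact: opp_d_notin.
  + by case/sq_eq => t; rewrite opprK add0r mul1r; exact: d_notin.
  + case/sq_eq => t; rewrite (_ : 1 - -1 = 3%:R - 1); last by ring.
    by rewrite three0 sub0r mulN1r; exact: opp_d_notin.
move=> E' EE'; have a' : wb2 E' = 0 by apply/eqP; rewrite (geom_wb2_eq0 EE') aE.
have [k kE] := gen (wb4_neq0 a').
(* If k is 2 or 3 modulo 4, then k + (q - 1) is 0 or 1 modulo 4. *)
have [m mE] : exists m, wb4 E' = (g ^+ m) ^+ 4 * g ^+ (odd k).
  have [k4|k4] := ltnP (k %% 4) 2.
    exists (k %/ 4)%N; rewrite kE -exprM -exprD; congr (_ ^+ _).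
    by case ok: (odd k); lia.
  exists ((k + #|Fq|.-1) %/ 4)%N; rewrite -[LHS]mulr1 -(prim_expr_order gP) kE.
  rewrite -exprM -!exprD; congr (_ ^+ _).
  by rewrite card_Fq; case ok: (odd k); lia.
have gm0 : g ^+ m != 0 by rewrite expf_neq0.
case ok: (odd k) mE => mE.
  exists 3%N => //=; have [a b c] := pow_curveP 1.
  exact: nonsquare_equivalent q1 _ gm0 a a' b c mE.
rewrite /= expr0 -(expr1n _ 2) in mE.
have [e eP eE] := square_equivalent n10 gm0 a' mE.
have {}eE : equivalent (sq_curve 1 e) E'.
  by have [a b c] := sq_curveP e n10; exact: eE.
by case: eP eE => -> eE; [exists 0%N | exists 1%N | exists 2%N].
Qed.

Lemma card_Twist_supersingular_even E : ~~ odd n -> (0 < n)%N -> wb2 E = 0 ->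
  (Twist iota E #= `I_6)%card.
Proof.
move=> on n0 aE; have q4 : (3 ^ n %% 4 = 1)%N by rewrite pow3_mod4 (negPf on).
have q1 : (4 %| #|Fq|.-1)%N by rewrite card_Fq; lia.
have q2 : (2 %| #|Fq|.-1)%N by apply: dvdn_trans q1.
have n10 := oner_neq0 Fq.
have [v v2] := exists_sqrt_opp1 on n0.
have dist i j E1 E2 : wb2 E1 = 0 -> wb2 E2 = 0 -> wb4 E1 = g ^+ i ->
    wb4 E2 = g ^+ j -> (i < 4)%N -> (j < 4)%N -> i != j -> ~ equivalent E1 E2.
  move=> a1 a2 b1 b2 i4 j4 ij /(power_mod_equivalent q1 isT a1 a2 b1 b2).
  by rewrite !modn_small // => /eqP; apply/negP.
have sq_eq h : h != 0 -> ~ equivalent (sq_curve h 0) (sq_curve h 1).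
  move=> h0; have [a b c] := sq_curveP 0 h0; have [a' b' c'] := sq_curveP 1 h0.
  case/(square_equivalent_inv h0 a a' b b' c c') => u [t [_ _]].
  by rewrite mulr0 sub0r mulN1r; exact: opp_d_notin.
pose e := nth (pow_curve 3)
  [:: sq_curve 1 0; sq_curve 1 1; pow_curve 1; sq_curve g 0; sq_curve g 1].
(* The exponent of g in b4 for the representative of index i. *)
pose x i := nth 3%N [:: 0; 0; 1; 2; 2]%N i.
have x4 i : (x i < 4)%N.
  by rewrite /x; case: i => [|[|[|[|[|i]]]]] //=; rewrite nth_nil.
have eP i : wb2 (e i) = 0 /\ wb4 (e i) = g ^+ (x i).
  have [N1a N1b _] := pow_curveP 1; have [N3a N3b _] := pow_curveP 3.
  have [a0 b0 _] := sq_curveP 0 n10; have [a1 b1 _] := sq_curveP 1 n10.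
  have [a2 b2 _] := sq_curveP 0 g0; have [a3 b3 _] := sq_curveP 1 g0.
  rewrite expr1n in b0 b1.
  by rewrite /e /x; case: i => [|[|[|[|[|i]]]]] /=; rewrite ?nth_nil ?expr0; split.
apply: (@card_Twist_of_representatives _ _ e).
- by move=> i _; apply: supersingular_geom_equivalent => //; case: (eP i).
- move=> i j ij; have [ai bi] := eP i; have [aj bj] := eP j.
  have [xij|xij] := eqVneq (x i) (x j); last first.
    exact: dist ai aj bi bj (x4 i) (x4 j) xij.
  have : (i, j) \in [:: (0, 1); (3, 4)]%N.
    move: xij; rewrite /x.
    case: i j ij {ai bi aj bj} => [|[|[|[|[|i]]]]] [|[|[|[|[|[|j]]]]]] //= ij;
      exfalso; lia.
  rewrite !inE => /orP[]/eqP[-> ->]; exact: sq_eq.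
move=> E' EE'; have a' : wb2 E' = 0 by apply/eqP; rewrite (geom_wb2_eq0 EE') aE.
have [k kE] := gen (wb4_neq0 a').
have gm0 : g ^+ (k %/ 4) != 0 by rewrite expf_neq0.
have {}kE : wb4 E' = (g ^+ (k %/ 4)) ^+ 4 * g ^+ (k %% 4).
  by rewrite -exprM -exprD -divn_eq.
have sq h : h != 0 -> wb4 E' = (g ^+ (k %/ 4)) ^+ 4 * h ^+ 2 ->
    equivalent (sq_curve h 0) E' \/ equivalent (sq_curve h 1) E'.
  move=> h0 hE; have [eps epsP epsE] := square_equivalent h0 gm0 a' hE.
  have {}epsE : equivalent (sq_curve h eps) E'.
    by have [a b c] := sq_curveP eps h0; exact: epsE.
  case: epsP epsE => -> epsE; [by left | by right | right].
  apply: equivalent_trans epsE.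
  have [a b c] := sq_curveP 1 h0; have [a1 b1 c1] := sq_curveP (-1) h0.
  apply/equivalent_wb2_eq0 => //; exists v, 0; rewrite b b1 c c1.
  rewrite (exprM v 2 2) (exprM v 2 3) v2; split; try by ring.
  apply/eqP => v0; case/eqP: n10.
  by rewrite -[1]opprK -v2 v0 expr0n oppr0.
have odd_case i : odd i -> (k %% 4)%N = i -> equivalent (pow_curve i) E'.
  move=> oi ki; rewrite ki in kE; have [a b c] := pow_curveP i.
  exact: nonsquare_equivalent q2 oi gm0 a a' b c kE.
have : (k %% 4 < 4)%N by rewrite ltn_mod.
case ki: (k %% 4)%N => [|[|[|[|//]]]] _.
- case: (sq 1 n10); first by rewrite kE ki expr0 expr1n.
    by exists 0%N.
  by exists 1%N.
- by exists 2%N => //; exact: odd_case.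
- case: (sq g g0); first by rewrite kE ki.
    by exists 3%N.
  by exists 4%N.
- by exists 5%N => //; exact: odd_case.
Qed.
End Representatives.
End Supersingular.
End TwistsOverFiniteField.

Theorem proposition2p2 (n : nat) (hn : (1 <= n)%N)
    (Fq : finFieldType) (hq : #|Fq| = (3 ^ n)%N)
    (Fqbar : closedFieldType) (iota : {rmorphism Fq -> Fqbar})
    (halg : forall z : Fqbar, algebraicOver iota z)
    (E : ellcurve Fq) :
  [/\ jinv E != 0 -> (Twist iota E #= `I_2)%card,
      jinv E = 0 -> odd n -> (Twist iota E #= `I_4)%card
    & jinv E = 0 -> ~~ odd n -> (Twist iota E #= `I_6)%card].
Proof.
have three0 : 3%:R = 0 :> Fq := pcharf0 (card_finPcharP hq isT).
have [g [g0 gP gen]] := finField_generator Fq.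
have [d [d_notin cokernel]] := artin_schreier_cokernel three0.
have [C CP] := exists_curves0 hq.
split.
- rewrite jinv3_eq0 //; exact: (card_Twist_ordinary iota hq).
- move/eqP; rewrite jinv3_eq0 // => /eqP a0 on.
  exact: (card_Twist_supersingular_odd iota hq g0 gP gen d_notin cokernel CP).
- move/eqP; rewrite jinv3_eq0 // => /eqP a0 on.
  exact: (card_Twist_supersingular_even iota hq g0 gP gen d_notin cokernel CP).
Qed.
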